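(* Let $R$ be a Noetherian ring and let $I$ be a height unmixed ideal of $R$. Suppose that $I$ is generically a Gorenstein ideal and that $R_{\mathfrak p}$ is a regular local ring for all prime ideals $\mathfrak p$ minimal over $I$. Put $L=I\colon\sqrt{I}$. Then $I$ is integrally closed if and only if $$\sqrt{I} = IL\colon L^2 .$$ If either of these equivalent conditions holds, then $I$ is generically a complete intersection of Goto-type.
   Context: All rings are commutative. For ideals $A,B$ of $R$, $A\colon B=\{r\in R : rB\subseteq A\}$. The integral closure $\overline{I}$ of $I$ is the ideal of all $z\in R$ satisfying an equation $z^n+a_1z^{n-1}+\cdots+a_n=0$ with $a_i\in I^i$; $I$ is integrally closed if $I=\overline{I}$. The ideal $I$ is height unmixed if it is proper and all associated primes of $R/I$ have the same height, equal to the height of $I$. An ideal $I$ satisfies a property generically if $I_{\mathfrak p}\subset R_{\mathfrak p}$ satisfies it for every minimal prime $\mathfrak p$ of $I$; thus $I$ is generically Gorenstein if $R_{\mathfrak p}/I_{\mathfrak p}$ is a Gorenstein ring for every minimal prime $\mathfrak p$ of $I$. An ideal $I$ in a local ring $R$ is a complete intersection of Goto-type if $R$ is regular of some dimension $d$ and $I=(x_1,\ldots,x_{d-1},x_d^t)$ for some regular system of parameters $x_1,\ldots,x_d$ of $R$ and some integer $t\geq 1$ (when $d=0$ this means $I=0$). *)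

(* Defs.v *)
From HB Require Import structures.
From mathcomp Require Import all_boot all_algebra.
From mathcomp Require Import boolp classical_sets ring.

Set Implicit Arguments.
Unset Strict Implicit.
Unset Printing Implicit Defensive.

Import GRing.Theory.
Local Open Scope ring_scope.
Local Open Scope classical_set_scope.
Local Open Scope quotient_scope.

(* MathComp's [idealr R] is the type of proper ideals and [prime_idealr R] that
   of prime ideals.  Arbitrary ideals, which may be the whole ring, are
   classical sets satisfying [is_ideal]. *)

Section Ideals.
Variable R : comNzRingType.
Implicit Types I J S : set R.

Definition is_ideal I : Prop :=
  I 0 /\ forall a x y, I x -> I y -> I (a * x + y).

Definition ideal_gen S : set R := smallest is_ideal S.

Definition ideal_mul I J : set R := ideal_gen [set x * y | x in I & y in J].

Definition ideal_pow I n : set R := iter n (ideal_mul I) setT.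

Definition ideal_colon I J : set R := [set r | forall b, J b -> I (r * b)].

Definition radical I : set R := [set x | exists n, I (x ^+ n)].

Definition integral_closure I : set R := [set z | exists n (a : nat -> R),
  [/\ (0 < n)%N,
      forall i, (1 <= i <= n)%N -> ideal_pow I i (a i) &
      z ^+ n + \sum_(1 <= i < n.+1) a i * z ^+ (n - i) = 0]].

Definition integrally_closed I : Prop := integral_closure I = I.

Definition noetherian : Prop :=
  forall I, is_ideal I -> exists s : seq R, I = ideal_gen [set` s].

Definition minimal_prime I (p : prime_idealr R) : Prop :=
  I `<=` [set` p] /\
  forall q : prime_idealr R, I `<=` [set` q] -> ~ [set` q] `<` [set` p].

(* The annihilator in R of the class of x in R/I is {r | r * x \in I}. *)
Definition associated_prime I (p : prime_idealr R) : Prop :=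
  exists x, [set` p] = [set r | I (r * x)].

Definition prime_chain (n : nat) (c : nat -> prime_idealr R) : Prop :=
  forall i, (i < n)%N -> [set` c i] `<` [set` c i.+1].

(* Heights and dimensions are values in N u {oo}; such a value h is handled
   through the predicate n <= h. *)
Definition prime_height_ge (p : prime_idealr R) (n : nat) : Prop :=
  exists2 c, prime_chain n c & [set` c n] = [set` p].

(* The height of I is the infimum of the heights of the primes containing I. *)
Definition ideal_height_ge I (n : nat) : Prop :=
  forall p : prime_idealr R, I `<=` [set` p] -> prime_height_ge p n.

Definition krull_dim_ge (n : nat) : Prop := exists c, prime_chain n c.

Definition krull_dim_eq (n : nat) : Prop :=
  krull_dim_ge n /\ ~ krull_dim_ge n.+1.

Definition height_unmixed I : Prop :=
  [/\ is_ideal I, ~ I 1 &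
      forall p, associated_prime I p ->
        forall n, prime_height_ge p n <-> ideal_height_ge I n].

Definition maximal_ideal (m : set R) : Prop :=
  [/\ is_ideal m, ~ m 1 &
      forall J, is_ideal J -> ~ J 1 -> m `<=` J -> J = m].

Definition local_ring_with (m : set R) : Prop :=
  maximal_ideal m /\ forall m', maximal_ideal m' -> m' = m.

(* R is a regular local ring of dimension d, with regular system of
   parameters x. *)
Definition regular_system_of_parameters (d : nat) (x : 'I_d -> R) : Prop :=
  [/\ noetherian, krull_dim_eq d & local_ring_with (ideal_gen (range x))].

Definition regular_local_ring : Prop :=
  exists d (x : 'I_d -> R), regular_system_of_parameters x.

(* For d = 0 the family of generators is empty, so that I = 0. *)
Definition ci_goto_type I : Prop :=
  exists d (x : 'I_d -> R) (t : nat),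
    [/\ regular_system_of_parameters x, (1 <= t)%N &
        I = ideal_gen (range (fun i : 'I_d =>
              if i.+1 == d then x i ^+ t else x i))].

End Ideals.

Arguments noetherian R : clear implicits.
Arguments krull_dim_ge R n : clear implicits.
Arguments krull_dim_eq R n : clear implicits.
Arguments regular_local_ring R : clear implicits.

Section Gorenstein.
Variable A : comNzRingType.

Definition injective_module (E : lmodType A) : Prop :=
  forall (M N : lmodType A) (i : {linear M -> N}) (f : {linear M -> E}),
    injective i -> exists g : {linear N -> E}, forall x, g (i x) = f x.

(* M has an injective resolution 0 -> M -> E 0 -> ... -> E n -> 0. *)
Definition finite_injective_dimension (M : lmodType A) : Prop :=
  exists (n : nat) (E : nat -> lmodType A) (e : {linear M -> E 0%N})
         (d : forall i, {linear E i -> E i.+1}),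
    [/\ forall i, injective_module (E i),
        forall i, (n < i)%N -> forall x : E i, x = 0,
        injective e,
        range e = [set y | d 0%N y = 0] &
        forall i, range (d i) = [set y | d i.+1 y = 0]].

Definition gorenstein_local_ring : Prop :=
  [/\ noetherian A, exists m, local_ring_with (R := A) m &
      finite_injective_dimension A^o].

End Gorenstein.

(* The quotient A/J by a proper ideal J is the library's [{ideal_quot K}], where
   K is J as a boolean predicate. *)
Definition gorenstein_ideal (A : comNzRingType) (J : set A) : Prop :=
  exists2 K : idealr A, [set` K] = J & gorenstein_local_ring {ideal_quot K}.

Module Localization.
Section Localization.
Variables (R : comNzRingType) (p : prime_idealr R).

Definition frac := {x : R * R | x.2 \notin p}.

Lemma frac_denM (s t : R) : s \notin p -> t \notin p -> s * t \notin p.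
Proof. by move=> hs ht; rewrite prime_idealrM negb_or hs. Qed.

Lemma frac_den1 : 1 \notin p.
Proof. by rewrite idealr1. Qed.

Definition mkfrac (a s : R) (hs : s \notin p) : frac :=
  exist (fun x : R * R => x.2 \notin p) (a, s) hs.

Definition num (x : frac) : R := (val x).1.
Definition den (x : frac) : R := (val x).2.

Lemma denP (x : frac) : den x \notin p.
Proof. exact: (valP x). Qed.

Definition eqv_prop (x y : frac) : Prop :=
  exists2 u, u \notin p & u * (num x * den y) = u * (num y * den x).

Definition eqv (x y : frac) : bool := `[< eqv_prop x y >].

Lemma eqv_refl : reflexive eqv.
Proof. by move=> x; apply/asboolP; exists 1; first exact: frac_den1. Qed.

Lemma eqv_sym : symmetric eqv.
Proof.
by move=> x y; apply/asboolP/asboolP => -[u hu e]; exists u.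
Qed.

Lemma eqv_trans : transitive eqv.
Proof.
move=> y x z /asboolP[u hu e] /asboolP[v hv f]; apply/asboolP.
exists (u * v * den y); first by rewrite !frac_denM ?denP.
have -> : u * v * den y * (num x * den z)
        = v * den z * (u * (num x * den y)) by ring.
have -> : u * v * den y * (num z * den x)
        = u * den x * (v * (num z * den y)) by ring.
by rewrite e -f; ring.
Qed.

Canonical eqv_equiv := EquivRel eqv eqv_refl eqv_sym eqv_trans.

Definition type := {eq_quot eqv}.
#[export]
HB.instance Definition _ : EqQuotient _ eqv type := EqQuotient.on type.
#[export]
HB.instance Definition _ := Choice.on type.

Lemma eqv_eq (x y : frac) : eqv_prop x y -> x = y %[mod type].
Proof. by move=> h; apply/eqmodP/asboolP. Qed.

Lemma eqv_repr (x : frac) : eqv_prop x (repr (\pi_type x)).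
Proof. by apply/asboolP; have /eqmodP := esym (reprK (\pi_type x)). Qed.

Definition addf (x y : frac) : frac :=
  mkfrac (num x * den y + num y * den x) (frac_denM (denP x) (denP y)).
Definition oppf (x : frac) : frac := mkfrac (- num x) (denP x).
Definition mulf (x y : frac) : frac :=
  mkfrac (num x * num y) (frac_denM (denP x) (denP y)).
Definition of_ring (a : R) : frac := mkfrac a frac_den1.

Lemma num_mkfrac a s (hs : s \notin p) : num (mkfrac a hs) = a.
Proof. by []. Qed.

Lemma den_mkfrac a s (hs : s \notin p) : den (mkfrac a hs) = s.
Proof. by []. Qed.

Definition fracE := (num_mkfrac, den_mkfrac).

Definition add := lift_op2 type addf.
Definition opp := lift_op1 type oppf.
Definition mul := lift_op2 type mulf.
Definition tolocal := lift_embed type of_ring.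
Canonical tolocal_pi_morph := PiEmbed tolocal.

Lemma pi_add : {morph \pi : x y / addf x y >-> add x y}.
Proof.
move=> x y; unlock add; apply: eqv_eq.
have [u hu e] := eqv_repr x; have [v hv f] := eqv_repr y.
move: (repr _) e (repr _) f => x' e y' f.
exists (u * v); first exact: frac_denM.
rewrite !fracE.
transitivity (v * den y * den y' * (u * (num x * den x'))
            + u * den x * den x' * (v * (num y * den y'))); first by ring.
by rewrite e f; ring.
Qed.
Canonical pi_add_morph := PiMorph2 pi_add.

Lemma pi_opp : {morph \pi : x / oppf x >-> opp x}.
Proof.
move=> x; unlock opp; apply: eqv_eq.
have [u hu e] := eqv_repr x.
move: (repr _) e => x' e; exists u => //.
by rewrite !fracE !mulNr !mulrN; congr (- _).
Qed.
Canonical pi_opp_morph := PiMorph1 pi_opp.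

Lemma pi_mul : {morph \pi : x y / mulf x y >-> mul x y}.
Proof.
move=> x y; unlock mul; apply: eqv_eq.
have [u hu e] := eqv_repr x; have [v hv f] := eqv_repr y.
move: (repr _) e (repr _) f => x' e y' f.
exists (u * v); first exact: frac_denM.
rewrite !fracE.
transitivity ((u * (num x * den x')) * (v * (num y * den y'))); first by ring.
by rewrite e f; ring.
Qed.
Canonical pi_mul_morph := PiMorph2 pi_mul.

Lemma frac_eq (x y : frac) : num x * den y = num y * den x -> x = y %[mod type].
Proof. by move=> h; apply: eqv_eq; exists 1; rewrite ?frac_den1 ?h. Qed.

Lemma addA : associative add.
Proof.
elim/quotW=> x; elim/quotW=> y; elim/quotW=> z; rewrite !piE.
by apply: frac_eq; rewrite !fracE; ring.
Qed.

Lemma addC : commutative add.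
Proof.
elim/quotW=> x; elim/quotW=> y; rewrite !piE.
by apply: frac_eq; rewrite !fracE; ring.
Qed.

Lemma add0 : left_id (tolocal 0) add.
Proof.
elim/quotW=> x; rewrite !piE.
by apply: frac_eq; rewrite !fracE; ring.
Qed.

Lemma addN : left_inverse (tolocal 0) opp add.
Proof.
elim/quotW=> x; rewrite !piE.
by apply: frac_eq; rewrite !fracE; ring.
Qed.

#[export]
HB.instance Definition _ := GRing.isZmodule.Build type addA addC add0 addN.

Lemma mulA : associative mul.
Proof.
elim/quotW=> x; elim/quotW=> y; elim/quotW=> z; rewrite !piE.
by apply: frac_eq; rewrite !fracE; ring.
Qed.

Lemma mulC : commutative mul.
Proof.
elim/quotW=> x; elim/quotW=> y; rewrite !piE.
by apply: frac_eq; rewrite !fracE; ring.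
Qed.

Lemma mul1 : left_id (tolocal 1) mul.
Proof.
elim/quotW=> x; rewrite !piE.
by apply: frac_eq; rewrite !fracE; ring.
Qed.

Lemma mulD : left_distributive mul add.
Proof.
elim/quotW=> x; elim/quotW=> y; elim/quotW=> z; rewrite !piE.
by apply: frac_eq; rewrite !fracE; ring.
Qed.

Lemma nonzero1 : tolocal 1 != tolocal 0.
Proof.
rewrite piE; apply/negP => /asboolP[u hu]; rewrite !fracE !mulr1 mulr0.
by move=> u0; move: hu; rewrite u0 idealr0.
Qed.

#[export]
HB.instance Definition _ :=
  GRing.Zmodule_isComNzRing.Build type mulA mulC mul1 mulD nonzero1.

End Localization.

Module Exports. HB.reexport. End Exports.
End Localization.

Export Localization.Exports.

Notation localization := Localization.type.
Notation tolocal := Localization.tolocal.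

Definition ideal_localization (R : comNzRingType) (p : prime_idealr R)
    (I : set R) : set (localization p) :=
  ideal_gen (tolocal p @` I).

Arguments ideal_localization {R} p I _.

Definition generically (P : forall A : comNzRingType, set A -> Prop)
    (R : comNzRingType) (I : set R) : Prop :=
  forall p : prime_idealr R, minimal_prime I p ->
    P (localization p) (ideal_localization p I).

(* Main.v *)
Require Import Defs.
From HB Require Import structures.
From mathcomp Require Import all_boot all_algebra perm.
From mathcomp Require Import boolp classical_sets ring zify.

(** Since [sqrt I * L] lies in [I], the inclusion of [sqrt I] in [IL : L^2] is
    automatic. The equality therefore says that [IL : L^2] lies in every minimal
    prime [p] of [I], i.e. that [L^2] and [IL] differ at every [p].

    If [I] is integrally closed, they do differ. Indeed [L] is larger than [I] at
    [p], because [p] is associated to [I], while [r L^2] inside [IL] puts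
    [r L] into the integral closure of [I] by the determinant trick
    ([colon_sub_radical]).

    The heart of the matter is the converse. Let [(A, m)] be the localization at
    [p] and [J] the extension of [I]; then [A / J] is an Artinian Gorenstein
    ring and [J : m] is the preimage of its socle. Finite injective dimension
    descends along the cosyzygies to self-injectivity, hence
    [0 : (0 : b) = (b)] in [A / J] ([double_annihilator]). Suppose that neither
    of [x1], [x2] divides the other modulo [J]. By duality there are [y1], [y2]
    such that [x1 y1] and [x2 y2] generate the socle while [x1 y2] and [x2 y1]
    lie in [J]; so a product of two socle elements is, up to [J (J : m)], a
    multiple of [(x1 y1) (x2 y2) = (x1 y2) (x2 y1)], and
    [(J : m)^2 = J (J : m)] ([socle_product]). Thus, if [L^2] and [IL] differ at
    [p], the principal ideals of [A / J] form a chain, [m] is generated by one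
    parameter modulo [J], and [J] is of Goto type
    ([goto_type_of_chain_ring]).

    An ideal [J = (x_1, ..., x_(d-1), x_d^t)] of Goto type is integrally closed:
    modulo the first [d - 1] parameters [A] becomes a discrete valuation ring
    and [J] a power of its maximal ideal ([goto_type_integrally_closed]). That
    [x_d] is not nilpotent in this quotient is Krull's height theorem. Finally
    [I] is integrally closed as soon as it is so at its minimal primes, for these
    are all its associated primes: [I] is unmixed and of finite height
    ([generically_mem]). *)

Set Implicit Arguments.
Unset Strict Implicit.
Unset Printing Implicit Defensive.

Import GRing.Theory.
Local Open Scope ring_scope.
Local Open Scope classical_set_scope.

(** * Ideals as sets *)

Section IdealCalculus.
Variable R : comNzRingType.
Implicit Types (I J K S : set R) (p q : prime_idealr R) (a b r u x y : R).

Lemma ideal_zero I : is_ideal I -> I 0.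
Proof. by case. Qed.

Lemma ideal_add I x y : is_ideal I -> I x -> I y -> I (x + y).
Proof. by case=> _ h Ix Iy; rewrite -[x]mul1r; apply: h. Qed.

Lemma ideal_mull I a x : is_ideal I -> I x -> I (a * x).
Proof. by case=> I0 h Ix; rewrite -[_ * _]addr0; apply: h. Qed.

Lemma ideal_mulr I a x : is_ideal I -> I x -> I (x * a).
Proof. by rewrite mulrC; apply: ideal_mull. Qed.

Lemma ideal_opp I x : is_ideal I -> I x -> I (- x).
Proof. by rewrite -mulN1r; apply: ideal_mull. Qed.

Lemma ideal_sub I x y : is_ideal I -> I x -> I y -> I (x - y).
Proof. by move=> hI Ix Iy; apply: ideal_add => //; apply: ideal_opp. Qed.

Lemma ideal_sum I (T : Type) (s : seq T) (P : pred T) (F : T -> R) :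
  is_ideal I -> (forall i, P i -> I (F i)) -> I (\sum_(i <- s | P i) F i).
Proof.
move=> hI h; elim/big_ind: _ => //; first exact: ideal_zero.
by move=> x y; apply: ideal_add.
Qed.

Lemma is_ideal_gen S : is_ideal (ideal_gen S).
Proof.
split=> [J [hJ _]|a x y Sx Sy J [hJ hS]]; first exact: ideal_zero.
by apply: ideal_add => //; [apply: ideal_mull => //; apply: Sx|apply: Sy].
Qed.

Lemma ideal_gen_incl S x : S x -> ideal_gen S x.
Proof. exact: sub_gen_smallest. Qed.

Lemma ideal_gen_min S J : is_ideal J -> S `<=` J -> ideal_gen S `<=` J.
Proof. exact: smallest_sub. Qed.

Lemma is_ideal_prime p : is_ideal [set` p].
Proof.
split=> [|a x y px py] /=; first exact: idealr0.
by rewrite rpredD // idealMr.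
Qed.

Lemma is_ideal_colon I J : is_ideal I -> is_ideal (ideal_colon I J).
Proof.
move=> hI; split=> [b _|a x y hx hy b Jb]; first by rewrite mul0r; case: hI.
by rewrite mulrDl -mulrA; apply: ideal_add => //; [apply: ideal_mull|]; auto.
Qed.

Lemma ideal_mul_incl I J x y : I x -> J y -> ideal_mul I J (x * y).
Proof. by move=> Ix Jy; apply: ideal_gen_incl; exists x => //; exists y. Qed.

Lemma is_ideal_mul I J : is_ideal (ideal_mul I J).
Proof. exact: is_ideal_gen. Qed.

Lemma ideal_mul_min I J K : is_ideal K ->
  (forall x y, I x -> J y -> K (x * y)) -> ideal_mul I J `<=` K.
Proof.
by move=> hK h; apply: ideal_gen_min => // _ [x Ix [y Jy <-]]; apply: h.
Qed.

Definition ideal_adjoin K b : set R :=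
  [set x | exists2 k, K k & exists r, x = k + r * b].

Lemma is_ideal_adjoin K b : is_ideal K -> is_ideal (ideal_adjoin K b).
Proof.
move=> hK; split; first by exists 0; [case: hK|exists 0; rewrite mul0r addr0].
move=> a _ _ [k Kk [r ->]] [k' Kk' [r' ->]].
exists (a * k + k'); first by case: hK => _; apply.
by exists (a * r + r'); ring.
Qed.

Lemma ideal_adjoin_sub K b : K `<=` ideal_adjoin K b.
Proof. by move=> k Kk; exists k => //; exists 0; rewrite mul0r addr0. Qed.

Lemma ideal_adjoin_mem K b : is_ideal K -> ideal_adjoin K b b.
Proof. by case=> K0 _; exists 0 => //; exists 1; rewrite add0r mul1r. Qed.

Lemma prime_of_set (Q : set R) : is_ideal Q -> ~ Q 1 ->
  (forall u v, Q (u * v) -> Q u \/ Q v) -> exists q, [set` q] = Q.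
Proof.
move=> [Q0 hQ] Q1 Qp; pose S : R -> bool := fun x => `[< Q x >].
have S_ideal : idealr_closed S.
  split; rewrite ?unfold_in /S; [exact/asboolP|exact/asboolPn|].
  by move=> a u v /asboolP Qu /asboolP Qv; apply/asboolP/hQ.
have S_prime : prime_idealr_closed S.
  move=> u v /asboolP /Qp[] h; apply/orP; [left|right]; exact/asboolP.
pose iI := isIdealr.Build R S S_ideal.
pose iP := isPrimeIdealrClosed.Build R S S_prime.
pose q : prime_idealr R := HB.pack S iI iP.
by exists q; apply/seteqP; split=> x /asboolP.
Qed.

Lemma prime_mulP p u v : u * v \in p -> u \in p \/ v \in p.
Proof. by rewrite prime_idealrM => /orP. Qed.

Lemma prime_notin_mul p u v : u \notin p -> v \notin p -> u * v \notin p.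
Proof. exact: Localization.frac_denM. Qed.

Lemma prime_notin1 p : 1 \notin p.
Proof. by rewrite idealr1. Qed.

Lemma prime_expP p x n : x ^+ n \in p -> x \in p.
Proof.
elim: n => [|n ih]; first by rewrite expr0 idealr1.
by rewrite exprS => /prime_mulP[].
Qed.

(** * Primes in a Noetherian ring *)

Hypothesis R_noeth : noetherian R.

(** The union of a chain of ideals is finitely generated, so it is already
    reached inside the chain and Zorn's lemma applies. The empty set is thrown
    in because the union of the empty chain has to belong to the family. *)
Lemma noetherian_maximal (P : set R -> Prop) :
    (forall K, P K -> is_ideal K) -> (exists K, P K) ->
  exists K, P K /\ forall K', P K' -> K `<=` K' -> K' `<=` K.
Proof.
move=> Pid [K0 PK0].
have [F FP Ftot|A [[A0|PA] Amax]] := @Zorn_bigcup R (fun A => A = set0 \/ P A).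
- have [[A FA PA]|nP] := pselect (exists2 A, F A & P A); last first.
    left; apply/seteqP; split=> // x [A FA Ax].
    by case: (FP A FA) => [A0|PA]; [rewrite A0 in Ax|case: nP; exists A].
  have U_ideal : is_ideal (\bigcup_(X in F) X).
    split; first by exists A => //; case: (Pid _ PA).
    move=> a x y [X FX Xx] [Y FY Yy].
    have [Z [FZ XZ YZ]] : exists Z, [/\ F Z, X `<=` Z & Y `<=` Z].
      by have [h|h] := Ftot _ _ FX FY; [exists Y; split|exists X; split].
    exists Z => //; case: (FP Z FZ) => [Z0|PZ]; first by move: (XZ _ Xx); rewrite Z0.
    by case: (Pid _ PZ) => _; apply; [apply: XZ|apply: YZ].
  have [s sU] := R_noeth U_ideal.
  have [Z [FZ PZ sZ]] : exists Z, [/\ F Z, P Z & [set` s] `<=` Z].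
    have: [set` s] `<=` \bigcup_(X in F) X by rewrite sU; apply: sub_gen_smallest.
    elim: s {sU} => [|x s ih] sU; first by exists A; split.
    have [Z [FZ PZ sZ]] := ih (fun y ys => sU y (mem_behead (s := x :: s) ys)).
    have [X FX Xx] := sU x (mem_head x s).
    have PX : P X by case: (FP X FX) => // X0; rewrite X0 in Xx.
    have [XZ|ZX] := Ftot _ _ FX FZ; [exists Z|exists X]; split=> // y;
      rewrite /= inE => /predU1P[->|ys]; auto.
  right; rewrite (_ : \bigcup_(X in F) X = Z) //; apply/seteqP; split.
    by rewrite sU; apply: ideal_gen_min => //; apply: Pid.
  by move=> x Zx; exists Z.
- case: (Amax K0); last by right.
  by rewrite A0; split=> // h; apply: (h 0); case: (Pid _ PK0).
- exists A; split=> // K' PK' AK'; apply: contrapT => nK'A.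
  by apply: (Amax K') => //; right.
Qed.

(** A maximal element among the proper ideals [K : r * x] is prime. *)
Lemma exists_prime_colon K x : is_ideal K -> ~ K x ->
  exists r q, ~ K (r * x) /\ [set` q] = [set s | K (s * (r * x))].
Proof.
move=> hK nKx; pose C y := [set s | K (s * y)].
have hC y : is_ideal (C y).
  split; rewrite /C /=; first by rewrite mul0r; case: hK.
  by move=> a s t; rewrite mulrDl -mulrA; case: hK => _; apply.
have [||A [[r [nKr ->]] Amax]] := @noetherian_maximal
    (fun A => exists r, ~ K (r * x) /\ A = C (r * x)).
- by move=> _ [r [_ ->]].
- by exists (C (1 * x)), 1; rewrite mul1r.
have [|u v|q qE] := @prime_of_set (C (r * x)) (hC _).
- by rewrite /C /= mul1r.
- move=> Kuv; have [Ku|nKu] := pselect (K (u * (r * x))); [by left|right].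
  apply: (Amax (C (u * r * x))) => [|s|]; rewrite /C /=.
  + by exists (u * r); rewrite -mulrA.
  + by move=> Ks; rewrite -mulrA mulrCA; apply: ideal_mull.
  + by move: Kuv; rewrite /C /= mulrC -!mulrA; congr K; ring.
by exists r, q; split.
Qed.

(** An ideal maximal among those that contain [I] and avoid [S] is prime. *)
Lemma exists_prime_disjoint I S : is_ideal I -> S 1 ->
    (forall u v, S u -> S v -> S (u * v)) -> (forall x, S x -> ~ I x) ->
  exists q, I `<=` [set` q] /\ forall x, S x -> x \notin q.
Proof.
move=> hI S1 SM SI; have [||A [[hA IA SA] Amax]] := @noetherian_maximal
    (fun A => [/\ is_ideal A, I `<=` A & forall x, S x -> ~ A x]).
- by move=> K [].
- by exists I; split.
have meet u : ~ A u -> exists2 s, S s & ideal_adjoin A u s.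
  move=> nAu; apply: contrapT => h; apply: nAu.
  apply: (Amax (ideal_adjoin A u)); last exact: ideal_adjoin_mem.
    split; first exact: is_ideal_adjoin.
      exact: subset_trans IA (@ideal_adjoin_sub _ _).
    by move=> s Ss As; apply: h; exists s.
  exact: ideal_adjoin_sub.
have [||u v Auv|q qE] := @prime_of_set A; rewrite ?qE //.
- exact: SA.
- apply: contrapT => /not_orP[nAu nAv].
  have [y Sy [a Aa [r yE]]] := meet _ nAu.
  have [z Sz [b Ab [t zE]]] := meet _ nAv.
  apply: (SA _ (SM _ _ Sy Sz)).
  rewrite yE zE (_ : _ * _ = (b + t * v) * a + (r * u * b + r * t * (u * v))); last by ring.
  by apply: ideal_add => //; [|apply: ideal_add => //]; apply: ideal_mull.
exists q; split; first by rewrite qE.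
by move=> x Sx; apply/negP => qx; apply: (SA x Sx); rewrite -qE.
Qed.

Lemma radical_prime I x : is_ideal I -> ~ radical I x ->
  exists q, I `<=` [set` q] /\ x \notin q.
Proof.
move=> hI nx; have [||_ [n ->]|q [Iq Sq]] :=
  @exists_prime_disjoint I [set y | exists n, y = x ^+ n] hI.
- by exists 0; rewrite expr0.
- by move=> _ _ [m ->] [n ->]; exists (m + n)%N; rewrite exprD.
- by move=> Ixn; apply: nx; exists n.
by exists q; split=> //; apply: Sq; exists 1; rewrite expr1.
Qed.

(** The complements of the minimal primes of [I] are the maximal multiplicative
    sets that avoid [I]. *)
Lemma exists_minimal_prime I q : is_ideal I -> I `<=` [set` q] ->
  exists2 p, minimal_prime I p & [set` p] `<=` [set` q].
Proof.
move=> hI Iq; pose mult S := [/\ S 1, (forall u v, S u -> S v -> S (u * v)),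
  (forall x, S x -> ~ I x) & forall x, x \notin q -> S x].
have mq (q' : prime_idealr R) : I `<=` [set` q'] -> [set` q'] `<=` [set` q] ->
    mult [set x | x \notin q'].
  move=> Iq' q'q; split=> /=; first exact: prime_notin1.
  - by move=> u v; apply: prime_notin_mul.
  - by move=> x /negP nx Ix; apply: nx; apply: Iq'.
  - by move=> x; apply: contra => /q'q.
have [F FP Ftot|S [mS Smax]] := @Zorn_bigcup R (fun S => S = set0 \/ mult S).
  have [[A FA mA]|nP] := pselect (exists2 A, F A & mult A); last first.
    left; apply/seteqP; split=> // x [A FA Ax].
    by case: (FP A FA) => [A0|PA]; [rewrite A0 in Ax|case: nP; exists A].
  have mF X x : F X -> X x -> mult X by move=> FX Xx; case: (FP X FX) => // X0; rewrite X0 in Xx.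
  right; split.
  - by exists A => //; case: mA.
  - move=> u v [X FX Xu] [Y FY Yv].
    have [XY|YX] := Ftot _ _ FX FY; [exists Y|exists X] => //.
      by case: (mF _ _ FY Yv) => _ h _ _; apply: h => //; apply: XY.
    by case: (mF _ _ FX Xu) => _ h _ _; apply: h => //; apply: YX.
  - by move=> x [X FX Xx]; case: (mF _ _ FX Xx) => _ _ h _; apply: h.
  - by move=> x qx; exists A => //; case: mA => _ _ _; apply.
have {}mS : mult S.
  case: mS => // S0; case: (Smax [set x | x \notin q]).
    by rewrite S0; split=> // h; apply: (h 1); apply: prime_notin1.
  by right; apply: mq.
have [S1 SM SI Sq] := mS.
have [p [Ip Sp]] := exists_prime_disjoint hI S1 SM SI.
have pq : [set` p] `<=` [set` q].
  by move=> x /= px; apply: contraLR px => /Sq; apply: Sp.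
exists p => //; split=> // p' Ip' [p'p npp'].
apply: (Smax [set x | x \notin p']); last by right; apply: mq => //; apply: subset_trans pq.
split; first by move=> x Sx /=; apply: contra (Sp x Sx) => /p'p.
by move=> h; apply: npp' => x /= px; apply: contraLR px => /h; apply: Sp.
Qed.

(** [R_p] has only one prime over [I], so the elements of [p] become nilpotent
    modulo [I] in [R_p]. *)
Lemma minimal_prime_nilpotent I p x : is_ideal I -> minimal_prime I p ->
  x \in p -> exists2 u, u \notin p & radical I (u * x).
Proof.
move=> hI [Ip pmin] px; apply: contrapT => h.
pose S := [set y | exists u n, u \notin p /\ y = u * x ^+ n].
have [||_ [u [n [pu ->]]] Iu|q [Iq Sq]] := @exists_prime_disjoint I S hI.
- by exists 1, 0; rewrite expr0 mulr1 prime_notin1.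
- move=> _ _ [u [m [pu ->]]] [v [n [pv ->]]]; exists (u * v), (m + n)%N.
  by rewrite prime_notin_mul // exprD; split=> //; ring.
- apply: h; exists u => //; exists n.+1.
  rewrite (_ : _ ^+ _ = (u ^+ n * x) * (u * x ^+ n)); first exact: ideal_mull.
  by rewrite exprMn !exprS; ring.
apply: (pmin q Iq); split=> [y /= qy|pq].
  apply: contraLR qy => py; apply: Sq; exists y, 0.
  by rewrite expr0 mulr1.
have /negP[] : x \notin q by apply: Sq; exists 1, 1; rewrite mul1r expr1 prime_notin1.
exact: pq.
Qed.

(** * Contractions of localized ideals *)

(** The contraction to [R] of the extension of [K] to the localization at [p]. *)
Definition saturation p K : set R := [set a | exists2 u, u \notin p & K (u * a)].

Lemma is_ideal_saturation p K : is_ideal K -> is_ideal (saturation p K).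
Proof.
move=> hK; split; first by exists 1; [exact: prime_notin1|rewrite mulr0; case: hK].
move=> a x y [u pu Ku] [v pv Kv]; exists (u * v); first exact: prime_notin_mul.
rewrite (_ : _ * _ = v * a * (u * x) + u * (v * y)); last by ring.
by apply: ideal_add => //; apply: ideal_mull.
Qed.

Lemma saturation_sub p K : K `<=` saturation p K.
Proof. by move=> x Kx; exists 1; rewrite ?prime_notin1 ?mul1r. Qed.

Lemma saturation_cancel p K u a : u \notin p ->
  saturation p K (u * a) -> saturation p K a.
Proof. by move=> pu [v pv Kv]; exists (v * u); [apply: prime_notin_mul|rewrite -mulrA]. Qed.

Lemma saturation_prime p q : [set` q] `<=` [set` p] -> saturation p [set` q] `<=` [set` q].
Proof. by move=> qp x [u pu /prime_mulP[/qp qu|//]]; rewrite qu in pu. Qed.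

Lemma saturation_mono p K J : K `<=` J -> saturation p K `<=` saturation p J.
Proof. by move=> KJ x [u pu Ku]; exists u => //; apply: KJ. Qed.

(** Finitely many denominators have a common multiple. *)
Lemma common_denominator p J K : is_ideal J -> is_ideal K ->
  K `<=` saturation p J -> exists2 u, u \notin p & forall k, K k -> J (u * k).
Proof.
move=> hJ hK KJ; have [s sK] := R_noeth hK.
have: [set` s] `<=` saturation p J.
  by apply: subset_trans KJ; rewrite sK; apply: sub_gen_smallest.
have [u pu uJ] : exists2 u, u \notin p &
    [set` s] `<=` saturation p J -> forall k, k \in s -> J (u * k).
  elim: s {sK} => [|k s [u pu ih]]; first by exists 1; rewrite ?prime_notin1.
  have [ks|nks] := pselect ([set` k :: s] `<=` saturation p J); last first.
    by exists 1; rewrite ?prime_notin1.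
  have [v pv Jv] := ks k (mem_head k s).
  exists (u * v) => [|_ x]; first exact: prime_notin_mul.
  rewrite inE => /predU1P[->|xs]; first by rewrite -mulrA; apply: ideal_mull.
  rewrite mulrAC; apply: ideal_mulr => //; apply: ih => // y ys.
  exact/ks/mem_behead.
move=> /uJ {}uJ; exists u => // k Kk.
have: ideal_gen [set` s] k by rewrite -sK.
apply: (@ideal_gen_min _ [set k | J (u * k)]) => // {k Kk}.
split=> /=; first by rewrite mulr0; case: hJ.
by move=> a x y; rewrite mulrDr mulrCA; case: hJ => _; apply.
Qed.

End IdealCalculus.

(** * Krull's height theorem *)

Section KrullHeight.
Variable R : comNzRingType.
Hypothesis R_noeth : noetherian R.
Implicit Types (I J K S : set R) (p q : prime_idealr R) (a b r u x y : R).

(** As [p] is minimal over [K0], the ring [R_p / K0 R_p] is Artinian. The proof is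
    by Noetherian induction on an ideal [K] below the whole chain: some [b]
    outside [K] has [p b] inside [K], and a chain that does not stay above
    [K + (b)] is eventually determined by the chain of its sums with [(b)]. *)
Lemma local_descending_chain p K0 (F : nat -> set R) :
    is_ideal K0 ->
    (forall q, K0 `<=` [set` q] -> [set` q] `<=` [set` p] -> [set` p] `<=` [set` q]) ->
    (forall n, is_ideal (F n)) -> (forall n, saturation p (F n) `<=` F n) ->
    (forall n, F n.+1 `<=` F n) -> (forall n, K0 `<=` F n) ->
  exists n, F n `<=` F n.+1.
Proof.
move=> hK0 pmin hF sF dF K0F.
pose chain K (G : nat -> set R) := [/\ forall n, is_ideal (G n),
  forall n, saturation p (G n) `<=` G n, forall n, G n.+1 `<=` G n &
  forall n, K `<=` G n].
pose stable (G : nat -> set R) := exists N, forall n, (N <= n)%N -> G n `<=` G n.+1.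
suff [N] : stable F by exists N; auto.
apply: contrapT => nF.
have [||K [[hK sK K0K [G [hG nG]]] Kmax]] := @noetherian_maximal R R_noeth
  (fun K => [/\ is_ideal K, saturation p K `<=` K, K0 `<=` K &
             exists G, chain K G /\ ~ stable G]).
- by move=> K [].
- exists (saturation p K0); split.
  + exact: is_ideal_saturation.
  + by move=> a [u pu]; apply: saturation_cancel.
  + exact: saturation_sub.
  + exists F; split=> //; split=> // n; apply: subset_trans (sF n).
    exact: saturation_mono.
have [iG sG dG KG] := hG.
have [K1|nK1] := pselect (K 1).
  by apply: nG; exists 0%N => n _ a _; rewrite -[a]mulr1; apply: ideal_mull (KG _ _ _).
have [b [q [nKb qE]]] := exists_prime_colon R_noeth hK nK1.
rewrite mulr1 in nKb.
(* The annihilator of [b] modulo [K] is a prime between [K0] and [p]. *)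
have {q qE} pb r : r \in p -> K (r * b).
  have -> : K (r * b) = [set` q] r by rewrite qE /= mulr1.
  apply: pmin => [k Kk|s]; rewrite qE /= mulr1.
    by apply: ideal_mulr => //; apply: K0K.
  by move=> Ks; apply: contrapT => /negP ps; apply: nKb; apply: sK; exists s.
have above G' : (forall n, is_ideal (G' n)) ->
    (forall n, saturation p (G' n) `<=` G' n) -> (forall n, G' n.+1 `<=` G' n) ->
    (forall n, K `<=` G' n) -> (forall n, G' n b) -> stable G'.
  move=> iG' sG' dG' KG' bG'; apply: contrapT => nG'; apply: nKb.
  apply: (Kmax (saturation p (ideal_adjoin K b))).
  - split.
    + exact/is_ideal_saturation/is_ideal_adjoin.
    + by move=> a [u pu]; apply: saturation_cancel.
    + by move=> a K0a; apply/saturation_sub/ideal_adjoin_sub/K0K.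
    + exists G'; split=> //; split=> // n; apply: subset_trans (sG' n).
      apply: saturation_mono => _ [k Kk [r ->]].
      by apply: ideal_add => //; [apply: KG'|apply: ideal_mull].
  - by move=> a Ka; apply/saturation_sub/ideal_adjoin_sub.
  - exact/saturation_sub/ideal_adjoin_mem.
have [N nGb] : exists N, ~ G N b.
  by apply: contrapT => /forallNP h; apply: nG; apply: above => // n; apply: contrapT.
have [|||||N' G'N'] := @above (fun n => saturation p (ideal_adjoin (G n) b)).
- by move=> n; apply/is_ideal_saturation/is_ideal_adjoin.
- by move=> n a [u pu]; apply: saturation_cancel.
- by move=> n; apply: saturation_mono => _ [k Gk [r ->]]; exists k; [apply: dG|exists r].
- by move=> n k Kk; apply/saturation_sub/ideal_adjoin_sub/KG.
- by move=> n; apply/saturation_sub/ideal_adjoin_mem.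
apply: nG; exists (maxn N N') => n; rewrite geq_max => /andP[Nn N'n] a Ga.
have {N nGb Nn} nGb : ~ G n b.
  move=> Gb; apply: nGb; elim: n Nn Gb {N'n Ga} => [|n ih].
    by rewrite leqn0 => /eqP->.
  by rewrite leq_eqVlt => /orP[/eqP->//|/ih{}ih /dG].
have [u pu [i Gi [r uaE]]] : saturation p (ideal_adjoin (G n.+1) b) a.
  by apply: G'N' => //; apply/saturation_sub/ideal_adjoin_sub.
apply: (sG n.+1); exists u => //; rewrite uaE; apply: ideal_add => //.
apply: KG; apply: pb; apply: contrapT => /negP pr; apply: nGb.
apply: sG; exists r => //; rewrite (_ : r * b = u * a - i); last by rewrite uaE; ring.
by apply: ideal_sub => //; [apply: ideal_mull|apply: dG].
Qed.

(** Nakayama's lemma at [p] for [K] inside [K' + x K]. A saturated ideal [N]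
    maximal among those that contain [K'] but not [K] would make [(K + N) / N]
    simple at [p], hence killed by [x]. *)
Lemma local_nakayama p K K' x : is_ideal K -> is_ideal K' -> x \in p ->
    (forall a, K a -> exists u k, [/\ u \notin p, K k & K' (u * a - x * k)]) ->
  K `<=` saturation p K'.
Proof.
move=> hK hK' px KK'; apply: contrapT => nK.
have [||N [[hN sN K'N nKN] Nmax]] := @noetherian_maximal R R_noeth
  (fun N => [/\ is_ideal N, saturation p N `<=` N, K' `<=` N & ~ K `<=` N]).
- by move=> K1 [].
- exists (saturation p K'); split=> //.
  + exact: is_ideal_saturation.
  + by move=> a [u pu]; apply: saturation_cancel.
  + exact: saturation_sub.
have [b Kb nNb] : exists2 b, K b & ~ N b.
  by apply: contrapT => h; apply: nKN => b Kb; apply: contrapT => nNb; apply: h; exists b.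
have KNb : K `<=` saturation p (ideal_adjoin N b).
  apply: contrapT => nKNb; apply: nNb.
  apply: (Nmax (saturation p (ideal_adjoin N b))).
  - split=> //.
    + exact/is_ideal_saturation/is_ideal_adjoin.
    + by move=> a [u pu]; apply: saturation_cancel.
    + by move=> a K'a; apply/saturation_sub/ideal_adjoin_sub/K'N.
  - by move=> a Na; apply/saturation_sub/ideal_adjoin_sub.
  - exact/saturation_sub/ideal_adjoin_mem.
have [u [k [pu Kk K'ubxk]]] := KK' b Kb.
have [v pv [n' Nn' [r vkE]]] := KNb k Kk.
apply: nNb; apply: sN; exists (u * v - x * r).
  apply: contra (prime_notin_mul pu pv) => h.
  by rewrite -[u * v](subrK (x * r)) rpredD // mulrC idealMr.
rewrite (_ : _ * b = v * (u * b - x * k) + x * n').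
  by apply: ideal_add => //; apply: ideal_mull => //; apply: K'N.
by rewrite (_ : n' = v * k - r * b); [ring|rewrite vkE; ring].
Qed.

(** Krull's principal ideal theorem modulo [q0]: no prime minimal over
    [q0 + (x)] has height two over [q0]. For [y] in [q1] outside [q0], the
    contractions [D n] of the ideals [q0 + (y ^+ n)] from the localization at
    [q1] stabilise locally at [p]: modulo [x] because [p] is minimal over
    [q0 + (x)], and then outright by Nakayama because [x] does not divide zero
    modulo [D n]. But [y ^+ n] in [D n.+1] would put [y] in [q0] or a unit
    into [q1]. *)
Lemma principal_ideal_theorem (q0 q1 p : prime_idealr R) x :
    [set` q0] `<` [set` q1] -> [set` q1] `<` [set` p] -> x \in p ->
  exists q, [/\ [set` q0] `<=` [set` q], x \in q & [set` q] `<` [set` p]].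
Proof.
move=> [q01 nq10] [q1p npq1] px; apply: contrapT => nq.
have pmin q : [set` q0] `<=` [set` q] -> x \in q -> [set` q] `<=` [set` p] ->
    [set` p] `<=` [set` q].
  by move=> q0q qx qp; apply: contrapT => npq; apply: nq; exists q; split.
have q1x : x \notin q1 by apply/negP => q1x; apply: npq1; apply: pmin.
have [y q1y q0y] : exists2 y, y \in q1 & y \notin q0.
  apply: contrapT => h; apply: nq10 => y /= q1y.
  by apply: contrapT => /negP q0y; apply: h; exists y.
have hq0 := is_ideal_prime q0.
pose D n := saturation q1 (ideal_adjoin [set` q0] (y ^+ n)).
have hD n : is_ideal (D n) by apply/is_ideal_saturation/is_ideal_adjoin.
have q0D n : [set` q0] `<=` D n.
  by move=> a q0a; apply/saturation_sub/ideal_adjoin_sub.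
have dD n : D n.+1 `<=` D n.
  apply: saturation_mono => _ [k q0k [r ->]]; exists k => //.
  by exists (r * y); rewrite exprS mulrA.
have [||||||n Dn] := @local_descending_chain p (ideal_adjoin [set` q0] x)
    (fun n => saturation p (ideal_adjoin (D n) x)).
- exact: is_ideal_adjoin.
- move=> q q0q qp; apply: pmin => //.
    by move=> a q0a; apply/q0q/ideal_adjoin_sub.
  exact/q0q/ideal_adjoin_mem.
- by move=> n; apply/is_ideal_saturation/is_ideal_adjoin.
- by move=> n a [u pu]; apply: saturation_cancel.
- by move=> n; apply: saturation_mono => _ [k Dk [r ->]]; exists k; [apply: dD|exists r].
- move=> n _ [k q0k [r ->]]; apply: saturation_sub.
  by exists k; [apply: q0D|exists r].
have {}Dn : D n `<=` saturation p (D n.+1).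
  apply: (@local_nakayama p (D n) (D n.+1) x) => // a Da.
  have [|u pu [d Dd [r uaE]]] := Dn a; first exact/saturation_sub/ideal_adjoin_sub.
  exists u, r; split=> //; last by rewrite (_ : _ - _ = d) // uaE; ring.
  apply: (saturation_cancel q1x); rewrite (_ : x * r = u * a - d); last by rewrite uaE; ring.
  exact: ideal_sub (hD n) (ideal_mull _ (hD n) Da) (dD _ _ Dd).
have [|v pv Dv] := Dn (y ^+ n); first exact/saturation_sub/ideal_adjoin_mem.
have [u q1u [k q0k [r uE]]] : D n.+1 (y ^+ n).
  by apply: saturation_cancel Dv; apply: contra pv => /q1p.
have kE : y ^+ n * (u - r * y) = k by rewrite mulrBr [_ * u]mulrC uE exprS; ring.
have /prime_mulP[/prime_expP|q0ury] : y ^+ n * (u - r * y) \in q0 by rewrite kE.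
  by apply/negP.
move/negP: q1u; apply; rewrite -[u](subrK (r * y)) rpredD ?idealMr //.
exact: q01.
Qed.

Lemma prime_chain_sub n (c : nat -> prime_idealr R) i j : prime_chain n c ->
  (i <= j <= n)%N -> [set` c i] `<=` [set` c j].
Proof.
move=> hc; elim: j => [|j ih] /andP[]; first by rewrite leqn0 => /eqP-> _ x.
rewrite leq_eqVlt => /orP[/eqP-> _ x //|ij] jn.
by apply: subset_trans (ih _) (hc _ jn).1; rewrite -ltnS ij ltnW.
Qed.

(** Reroute the chain from the top: the principal ideal theorem puts a prime
    that contains [x] between [c n] and [c n.+2]. *)
Lemma prime_chain_through n (c : nat -> prime_idealr R) x :
    prime_chain n.+1 c -> x \in c n.+1 ->
  exists c', [/\ prime_chain n.+1 c', c' 0%N = c 0%N, c' n.+1 = c n.+1 & x \in c' 1%N].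
Proof.
elim: n c => [|n ih] c hc cx; first by exists c.
have [q [cq qc qx]] : exists q, [/\ [set` c n] `<` [set` q],
    [set` q] `<` [set` c n.+2] & x \in q].
  have [c1x|nc1x] := boolP (x \in c n.+1); first by exists (c n.+1); split=> //; apply: hc.
  have [||q [cq qx qc]] := principal_ideal_theorem (hc n _) (hc n.+1 _) cx => //.
  exists q; split=> //; split=> // qcn; move/negP: nc1x; apply.
  exact/(hc n (leqW (leqnn _))).1/qcn.
have [||c' [hc' c'0 c'n c'x]] := ih (fun i => if i == n.+1 then q else c i).
- move=> i; rewrite ltnS leq_eqVlt => /orP[/eqP->|i_n].
    by rewrite eqxx ltn_eqF.
  by rewrite !ltn_eqF //; [apply: hc; rewrite !ltnS ltnW // ltnW|apply: leqW].
- by rewrite eqxx.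
rewrite eqxx in c'n.
exists (fun i => if (i <= n.+1)%N then c' i else c i); split=> //; last by rewrite ltnn.
move=> i; rewrite ltnS leq_eqVlt => /orP[/eqP->|i_n].
  by rewrite eqxx ltnn c'n.
by rewrite i_n orbT; apply: hc'.
Qed.

(** Krull's height theorem modulo [c 0]. Once the chain passes through the first
    element of [xs] at index one, its tail is a chain for the other elements. *)
Lemma krull_height n (c : nat -> prime_idealr R) (xs : seq R) :
    prime_chain n c -> {in xs, forall x, x \in c n} ->
    (forall q, [set` c 0%N] `<=` [set` q] -> [set` q] `<=` [set` c n] ->
       {in xs, forall x, x \in q} -> [set` c n] `<=` [set` q]) ->
  (n <= size xs)%N.
Proof.
elim: xs n c => [|x xs ih] [|n] c hc cxs cmin //.
  have [_ []] := hc 0%N isT.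
  apply: (@subset_trans _ [set` c n.+1]); first by apply: prime_chain_sub hc _; rewrite leqnn.
  by apply: cmin => //; apply: prime_chain_sub hc _; rewrite leqnn.
have [c' [hc' c'0 c'n c'x]] := prime_chain_through hc (cxs x (mem_head x xs)).
apply: (ih _ (fun i => c' i.+1)) => /= [i i_n|y ys|q c'q qc' qxs]; first exact: hc'.
  by rewrite c'n cxs // inE ys orbT.
rewrite c'n; apply: cmin; rewrite -?c'n -?c'0 //.
  by apply: subset_trans c'q; apply: prime_chain_sub hc' _.
by move=> y; rewrite inE => /predU1P[->|/qxs//]; apply: c'q.
Qed.

End KrullHeight.

(** * Zero-dimensional Gorenstein rings *)

Section IdealModule.
Variables (B : comNzRingType) (K : set B).
Hypothesis K_ideal : is_ideal K.

(** The proof argument lets the closure properties be attached to the predicate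
    as structure instances. *)
Definition ideal_pred (_ : is_ideal K) : {pred B^o} := fun x => `[< K x >].

Lemma ideal_pred_closed : subsemimod_closed (ideal_pred K_ideal).
Proof.
apply: GRing.submod_closed_semi; split; first by apply/asboolP; case: K_ideal.
by move=> a x y /asboolP Kx /asboolP Ky; apply/asboolP; case: K_ideal => _; apply.
Qed.

HB.instance Definition _ :=
  GRing.isSubmodClosed.Build B B^o (ideal_pred K_ideal) ideal_pred_closed.

Definition ideal_module := {x : B^o | x \in ideal_pred K_ideal}.
HB.instance Definition _ := SubChoice.on ideal_module.
HB.instance Definition _ := [SubChoice_isSubLmodule of ideal_module by <:].

Lemma injective_extension (E : lmodType B) (f : B -> E) : injective_module E ->
    (forall a x y, K x -> K y -> f (a * x + y) = a *: f x + f y) ->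
  exists e, forall x, K x -> f x = x *: e.
Proof.
move=> injE flin; pose g (x : ideal_module) : E := f (val x).
have g_lin : linear g.
  move=> a x y; rewrite /g linearP.
  by apply: flin; apply/asboolP; [exact: (valP x)|exact: (valP y)].
pose gl : {linear ideal_module -> E} :=
  HB.pack g (GRing.isLinear.Build B ideal_module E *:%R g g_lin).
have [|h hg] := injE ideal_module B^o (val : {linear ideal_module -> B^o}) gl.
  exact: val_inj.
exists (h 1) => x Kx; have Kx' : x \in ideal_pred K_ideal by apply/asboolP.
by rewrite -linearZ -[_ *: _]/(x * 1) mulr1; have /esym := hg (Sub x Kx').
Qed.

End IdealModule.

Section FiniteInjectiveDimension.
Variable B : comNzRingType.
Hypothesis B_noeth : noetherian B.
Hypothesis B_zerodim : forall b : B, (exists c, b * c = 1) \/ exists n, b ^+ n = 0.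
Implicit Types (K : set B) (E : lmodType B) (b c r : B).

Lemma in_prime_zerodim (q : prime_idealr B) r :
  (r \in q) = `[< exists n, r ^+ n = 0 >].
Proof.
apply/idP/asboolP => [qr|[n rn0]].
  case: (B_zerodim r) => // -[c rc1].
  by have /negP[] := prime_notin1 q; rewrite -rc1 mulrC idealMr.
by apply: (@prime_expP _ q _ n); rewrite rn0 idealr0.
Qed.

(** Extend the map from [K + (b)] to [E] that kills [K] and sends [b] to [e]. *)
Lemma injective_divide E K b (e : E) : injective_module E -> is_ideal K ->
    (forall r, K (r * b) -> r *: e = 0) ->
  exists e', (forall k, K k -> k *: e' = 0) /\ b *: e' = e.
Proof.
move=> injE hK be.
pose f x : E := xget 0 [set r | K (x - r * b)] *: e.
have fE x r : K (x - r * b) -> f x = r *: e.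
  move=> Kxr; rewrite /f; case: xgetP => [s _ Kxs|/(_ r)//].
  apply/eqP; rewrite -subr_eq0 -scalerBl; apply/eqP/be.
  rewrite (_ : _ * b = (x - r * b) - (x - s * b)); last by ring.
  exact: ideal_sub.
have [|a x y|e' fe'] := @injective_extension B (ideal_adjoin K b) _ E f injE.
- exact: is_ideal_adjoin.
- move=> [k Kk [r ->]] [l Kl [s ->]].
  rewrite (fE (k + r * b) r) ?addrK // (fE (l + s * b) s) ?addrK //.
  rewrite (fE _ (a * r + s)) ?scalerDl ?scalerA //.
  rewrite (_ : _ - _ = a * k + l); last by ring.
  by apply: ideal_add => //; apply: ideal_mull.
exists e'; split=> [k Kk|].
  by rewrite -fe'; [rewrite (fE _ 0) ?scale0r ?mul0r ?subr0|apply: ideal_adjoin_sub].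
rewrite -fe'; last exact: ideal_adjoin_mem.
by rewrite (fE _ 1) ?scale1r // mul1r subrr; case: hK.
Qed.

(** Injectivity of [Z] tested on the inclusions of principal ideals in [B]. *)
Definition principally_injective E (Z : set E) : Prop :=
  forall b z, Z z -> (forall r, r * b = 0 -> r *: z = 0) ->
  exists2 w, Z w & b *: w = z.

(** Surjectivity of [Hom(B/K, E) -> Hom(B/K, Z)], where [Z] is the image of
    [d]. For the residue field in place of [B/K], embed the residue field in
    [B] and extend the given map to [B], where it lifts; the other [K] follow by
    Noetherian induction along [K < K + (b)], whose successive quotient is the
    residue field. *)
Lemma lift_annihilated E E' (d : {linear E -> E'}) K :
    injective_module E -> principally_injective (range d) -> is_ideal K ->
  forall z, range d z -> (forall k, K k -> k *: z = 0) ->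
  exists e, (forall k, K k -> k *: e = 0) /\ d e = z.
Proof.
move=> injE injZ hK; apply: contrapT => nlift.
have [||{hK nlift}K [[hK /existsNP[z nlift]] Kmax]] := @noetherian_maximal B B_noeth
  (fun K => is_ideal K /\ ~ forall z, range d z -> (forall k, K k -> k *: z = 0) ->
            exists e, (forall k, K k -> k *: e = 0) /\ d e = z).
- by move=> ? [].
- by exists K.
move: nlift => /not_implyP[dz /not_implyP[Kz nlift]].
have [K1|nK1] := pselect (K 1).
  apply: nlift; exists 0; split=> [k _|]; first exact: scaler0.
  by rewrite linear0 -[z]scale1r Kz.
have [s [q0 [s0 q0E]]] := @exists_prime_colon B B_noeth [set 0] 1
  ltac:(split=> [//|a x y /= -> ->]; by rewrite mulr0 addr0) ltac:(exact/eqP/oner_neq0).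
have [b [q [nKb qE]]] := exists_prime_colon B_noeth hK nK1.
rewrite !mulr1 in s0 q0E nKb qE.
(* Both annihilators are the unique prime of [B]. *)
have qb r : K (r * b) <-> r * s = 0.
  have -> : K (r * b) = [set` q] r by rewrite qE.
  have -> : (r * s = 0) = [set` q0] r by rewrite q0E.
  by rewrite /= !in_prime_zerodim.
have [w [v _ <-] swE] : exists2 w, range d w & s *: w = b *: z.
  apply: injZ => [|r]; last by rewrite scalerA => /qb/Kz.
  by case: dz => y _ <-; exists (b *: y) => //; rewrite linearZ.
have [|e2 [Ke2 be2]] := @injective_divide E K b (s *: v) injE hK.
  by move=> r /qb rs0; rewrite scalerA rs0 scale0r.
have [e3 [Ke3 de3]] : exists e, (forall k, ideal_adjoin K b k -> k *: e = 0) /\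
    d e = z - d e2.
  apply: contrapT => nlift3; apply: nKb.
  apply: (Kmax (ideal_adjoin K b)); last exact: ideal_adjoin_mem.
    split; first exact: is_ideal_adjoin.
    move=> /(_ (z - d e2)) lift; apply: nlift3; apply: lift.
      by case: dz => y _ <-; exists (y - e2) => //; rewrite linearB.
    move=> _ [k Kk [r ->]]; rewrite scalerBr scalerDl Kz // add0r -linearZ.
    by rewrite scalerDl Ke2 // add0r -!scalerA be2 [d _]linearZ /= [d _]linearZ /= swE subrr.
  exact: ideal_adjoin_sub.
apply: nlift; exists (e2 + e3); split; last by rewrite linearD de3 addrC subrK.
by move=> k Kk; rewrite scalerDr Ke2 // Ke3 ?addr0 //; apply: ideal_adjoin_sub.
Qed.

(** Correct a solution [e0] in [E] by an element killed by [b] with the same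
    image under [d]. *)
Lemma principally_injective_kernel E E' (d : {linear E -> E'}) :
    injective_module E -> principally_injective (range d) ->
  principally_injective [set y | d y = 0].
Proof.
move=> injE injZ b z dz0 bz.
have h0 : is_ideal [set 0 : B].
  by split=> [//|a x y /= -> ->]; rewrite mulr0 addr0.
have [//|e0 [_ be0]] := @injective_divide E [set 0] b z injE h0.
have hb := is_ideal_adjoin b h0.
have [||e1 [be1 de1]] := @lift_annihilated _ _ d _ injE injZ hb (d e0).
- by exists e0.
- by move=> _ [_ -> [r ->]]; rewrite add0r -scalerA -[b *: _]linearZ /= be0 dz0 scaler0.
exists (e0 - e1); first by rewrite /= linearB /= de1 subrr.
by rewrite scalerBr be0 be1 ?subr0 //; apply: ideal_adjoin_mem.
Qed.

(** Dimension shifting down the injective resolution of [B] shows that [B] is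
    self-injective, whence this double annihilator condition. *)
Lemma double_annihilator : finite_injective_dimension B^o ->
  forall b c, (forall r, r * b = 0 -> r * c = 0) -> exists a, c = a * b.
Proof.
move=> [n [E [e [d [injE E0 inje ranE exE]]]]] b c bc.
have Zinj k i : (n < i + k)%N -> principally_injective [set y | d i y = 0].
  elim: k i => [|k ih] i; rewrite ?addn0 => ni.
    by move=> b' z _ _; exists 0; rewrite /= ?linear0 // [z]E0 // scaler0.
  apply: principally_injective_kernel => //.
  by rewrite exE; apply: ih; rewrite addSnnS.
have [|||w] := Zinj n.+1 0%N _ b (e c).
- by rewrite add0n.
- have : range e (e c) by exists c.
  by rewrite ranE.
- by move=> r /bc rc0; rewrite -linearZ -[r *: _]/(r * c) rc0 linear0.
rewrite -[_ w]/([set y | d 0%N y = 0] w) -ranE => -[a _ <-].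
by rewrite -linearZ => /inje <-; exists a; rewrite mulrC.
Qed.

End FiniteInjectiveDimension.

(** * Local rings *)

Section LocalRing.
Variables (A : comNzRingType) (m : set A).
Hypothesis A_noeth : noetherian A.
Hypothesis A_local : local_ring_with m.
Implicit Types (I J K P : set A) (a b r y z : A).

Lemma local_ideal : is_ideal m.
Proof. by case: A_local => -[]. Qed.

Lemma local_proper : ~ m 1.
Proof. by case: A_local => -[]. Qed.

Lemma proper_sub_local I : is_ideal I -> ~ I 1 -> I `<=` m.
Proof.
move=> hI nI1; have [||M [[hM nM1 IM] Mmax]] := @noetherian_maximal A A_noeth
  (fun K => [/\ is_ideal K, ~ K 1 & I `<=` K]).
- by move=> K [].
- by exists I; split.
have -> // : m = M; apply/esym/(A_local.2 M); split=> // J hJ nJ1 MJ.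
apply/seteqP; split=> //; apply: Mmax => //; split=> //.
exact: subset_trans MJ.
Qed.

Lemma local_unit u : ~ m u -> exists v, u * v = 1.
Proof.
move=> nmu; apply: contrapT => nu; apply: nmu.
apply: (@proper_sub_local [set x | exists v, x = u * v]).
- split; first by exists 0; rewrite mulr0.
  by move=> a _ _ [v ->] [w ->]; exists (a * v + w); ring.
- by move=> [v e]; apply: nu; exists v.
- by exists 1; rewrite mulr1.
Qed.

Lemma unit_notin_local u v : u * v = 1 -> ~ m u.
Proof.
by move=> uv mu; apply: local_proper; rewrite -uv; apply: ideal_mulr local_ideal mu.
Qed.

Lemma local_unit_cancel I u x : is_ideal I -> ~ m u -> I (u * x) -> I x.
Proof.
move=> hI /local_unit[v uv] Iux; rewrite -[x]mul1r -uv mulrAC.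
by rewrite mulrC; apply: ideal_mull.
Qed.

Lemma local_unit_exp u n : ~ m u -> ~ m (u ^+ n).
Proof.
by move=> /local_unit[v uv]; apply: (@unit_notin_local _ (v ^+ n)); rewrite -exprMn uv expr1n.
Qed.

Lemma local_prime : exists p : prime_idealr A, [set` p] = m.
Proof.
apply: prime_of_set local_ideal local_proper _ => u v muv.
have [|nmu] := pselect (m u); [by left|right].
exact: local_unit_cancel local_ideal nmu muv.
Qed.

(** Divide by [y] modulo [P] as long as the cofactor remains in [m]. *)
Lemma power_expansion P y z (t : nat) : is_ideal P -> m `<=` ideal_adjoin P y ->
  ideal_adjoin P (y ^+ t) z \/
  exists k g u, [/\ (k < t)%N, P g, ~ m u & z = g + u * y ^+ k].
Proof.
move=> hP mPy; elim: t => [|t [[g Pg [u zE]]|[k [g [u [kt Pg nmu zE]]]]]].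
- by left; exists 0; [case: hP|exists z; rewrite expr0 mulr1 add0r].
- have [/mPy[h Ph [r uE]]|nmu] := pselect (m u); [left|right].
    exists (g + h * y ^+ t); first by apply: ideal_add => //; apply: ideal_mulr.
    by exists r; rewrite zE uE exprS; ring.
  by exists t, g, u; split.
by right; exists k, g, u; split=> //; apply: ltnW.
Qed.

(** The case of an Artinian Gorenstein ring [A / J], whose ideals satisfy the
    double annihilator condition; its socle is [(J : m) / J]. *)
Section Socle.
Variable J : set A.
Hypothesis J_ideal : is_ideal J.
Hypothesis J_primary : forall x, m x -> exists n, J (x ^+ n).
Hypothesis J_gorenstein : forall b c,
  (forall r, J (r * b) -> J (r * c)) -> exists a, J (c - a * b).

Lemma socle_multiple x : ~ J x -> exists r, ideal_colon J m (r * x) /\ ~ J (r * x).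
Proof.
move=> /(exists_prime_colon A_noeth J_ideal)[r [q [nJrx qE]]].
exists r; split=> // a /J_primary[n Jan].
have qa : a \in q.
  apply: (@prime_expP _ q _ n); change ([set` q] (a ^+ n)).
  by rewrite qE /=; apply: ideal_mulr.
by move: qa; change ([set` q] a -> J (r * x * a)); rewrite qE /= mulrC.
Qed.

(** Every multiple of [t] is either in [J] or a unit multiple of [t], so [J : t]
    is [m], which sends [s] into [J]. *)
Lemma socle_one_dimensional s t : ideal_colon J m s -> ideal_colon J m t ->
  ~ J t -> exists a, J (s - a * t).
Proof.
move=> Js Jt nJt; apply: J_gorenstein => r Jrt.
have [mr|nmr] := pselect (m r); first by rewrite mulrC; apply: Js.
by case: nJt; apply: local_unit_cancel nmr Jrt.
Qed.

Lemma socle_dual x y : (forall a, ~ J (x - a * y)) ->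
  exists z, [/\ J (z * y), ideal_colon J m (z * x) & ~ J (z * x)].
Proof.
move=> nxy.
have [w [Jwy nJwx]] : exists w, J (w * y) /\ ~ J (w * x).
  apply: contrapT => h; have [a] := J_gorenstein
    (fun r Jry => contrapT (fun nJrx => h (ex_intro _ r (conj Jry nJrx)))).
  exact: nxy.
have [r [Lrwx nJrwx]] := socle_multiple nJwx.
by exists (r * w); rewrite -!mulrA; split=> //; apply: ideal_mull.
Qed.

(** When neither of [x1] and [x2] divides the other modulo [J], duality gives
    [y1] and [y2] such that [x1 y1] and [x2 y2] generate the socle while
    [x2 y1] and [x1 y2] lie in [J]. The product of two socle elements is then a
    multiple of [(x1 y1) (x2 y2) = (x1 y2) (x2 y1)], up to [J (J : m)]. *)
Lemma socle_product x1 x2 s1 s2 :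
    (forall a, ~ J (x1 - a * x2)) -> (forall a, ~ J (x2 - a * x1)) ->
    ideal_colon J m s1 -> ideal_colon J m s2 ->
  ideal_mul J (ideal_colon J m) (s1 * s2).
Proof.
move=> n12 n21 L1 L2.
have [y1 [Jyx1 Lt1 nJt1]] := socle_dual n12.
have [y2 [Jyx2 Lt2 nJt2]] := socle_dual n21.
have [a1 Ja1] := socle_one_dimensional L1 Lt1 nJt1.
have [a2 Ja2] := socle_one_dimensional L2 Lt2 nJt2.
have JL : J `<=` ideal_colon J m by move=> j Jj b _; apply: ideal_mulr.
have hL := is_ideal_colon m J_ideal.
rewrite (_ : s1 * s2 = a1 * a2 * ((y1 * x2) * (y2 * x1)) +
    ((s1 - a1 * (y1 * x1)) * s2 + (s2 - a2 * (y2 * x2)) * (a1 * (y1 * x1)))).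
  have hJL := @is_ideal_mul _ J (ideal_colon J m).
  apply: (ideal_add hJL); last apply: (ideal_add hJL).
  - by apply: (ideal_mull _ hJL); apply: ideal_mul_incl => //; apply: JL.
  - exact: ideal_mul_incl.
  - by apply: ideal_mul_incl => //; apply: (ideal_mull _ hL).
by ring.
Qed.

End Socle.

End LocalRing.

(** * Complete intersections of Goto type *)

Section GotoType.
Variable A : comNzRingType.
Implicit Types (I J K P : set A) (a b r y z : A).

Lemma ideal_gen_last n (g : 'I_n.+1 -> A) :
  ideal_gen (range g) =
  ideal_adjoin (ideal_gen (range (g \o lift ord_max))) (g ord_max).
Proof.
have hP := @is_ideal_gen A (range (g \o lift ord_max)).
apply/seteqP; split.
  apply: ideal_gen_min; first exact: is_ideal_adjoin.
  move=> _ [i _ <-]; case: (unliftP ord_max i) => [j|] ->.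
    by apply: ideal_adjoin_sub; apply: ideal_gen_incl; exists j.
  exact: ideal_adjoin_mem.
have hG := @is_ideal_gen A (range g).
move=> _ [k Pk [r ->]]; apply: (ideal_add hG); last first.
  by apply: (ideal_mull _ hG); apply: ideal_gen_incl; exists ord_max.
apply: ideal_gen_min Pk => // _ [i _ <-].
by apply: ideal_gen_incl; exists (lift ord_max i).
Qed.

Definition goto_generator d (x : 'I_d -> A) t (i : 'I_d) :=
  if i.+1 == d then x i ^+ t else x i.

Lemma goto_ideal_last n (x : 'I_n.+1 -> A) t :
  ideal_gen (range (goto_generator x t)) =
  ideal_adjoin (ideal_gen (range (x \o lift ord_max))) (x ord_max ^+ t).
Proof.
rewrite ideal_gen_last {2}/goto_generator eqxx.
rewrite (_ : goto_generator x t \o lift ord_max = x \o lift ord_max) //.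
by apply/funext => i; rewrite /= /goto_generator lift_max eqSS ltn_eqF.
Qed.

Lemma dominating_divisor J (s : seq A) : is_ideal J ->
    (forall a b, (exists r, J (a - r * b)) \/ (exists r, J (b - r * a))) ->
  s != [::] -> exists2 y, y \in s & {in s, forall z, exists r, J (z - r * y)}.
Proof.
move=> hJ Jtot; have J0 : J 0 by case: hJ.
have refl a : exists r, J (a - r * a) by exists 1; rewrite mul1r subrr.
elim: s => // a [_ _|b s /(_ isT)[y ys yP] _].
  by exists a; rewrite ?mem_head // => z; rewrite inE => /eqP->.
have [[r Jr]|[r Jr]] := Jtot a y.
  exists y; first by rewrite inE ys orbT.
  by move=> z; rewrite inE => /predU1P[->|/yP//]; exists r.
exists a; first exact: mem_head.
move=> z; rewrite inE => /predU1P[->//|/yP[c Jc]]; exists (c * r).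
rewrite (_ : _ - _ = (z - c * y) + c * (y - r * a)); last by ring.
by apply: ideal_add => //; apply: ideal_mull.
Qed.

(** As the principal ideals of [A / J] form a chain, one of the parameters
    generates [m] modulo [J]. The others can be corrected by multiples of it so
    as to lie in [J], and modulo them every element is a unit times a power of
    the one that is left. *)
Lemma goto_type_of_chain_ring d (x : 'I_d -> A) J :
    regular_system_of_parameters x -> is_ideal J -> ~ J 1 ->
    (forall y, ideal_gen (range x) y -> exists n, J (y ^+ n)) ->
    (forall a b, (exists r, J (a - r * b)) \/ (exists r, J (b - r * a))) ->
  ci_goto_type J.
Proof.
case: d x => [|d] x x_param hJ nJ1 Jnil Jtot; have [A_noeth A_dim A_local] := x_param.
  have x0 : range (goto_generator x 1) = range x by apply/seteqP; split=> y [[]].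
  exists 0%N, x, 1%N; split=> //; rewrite -/(goto_generator x 1) x0; apply/seteqP; split.
    exact: (proper_sub_local A_noeth A_local hJ nJ1).
  by apply: (ideal_gen_min hJ) => y [[]].
have [|_ /codomP[i0 ->] i0P] := @dominating_divisor J (codom x) hJ Jtot.
  by rewrite -size_eq0 size_codom card_ord.
have {i0P}[r rP] := choice (fun i => i0P (x i) (codom_f x i)).
(* The generator of [m] modulo [J] is moved to the last position. *)
pose tau := tperm i0 ord_max.
pose x' i := if i == ord_max then x i0 else x (tau i) - r (tau i) * x i0.
have x'max : x' ord_max = x i0 by rewrite /x' eqxx.
have x'J i : J (x' (lift ord_max i)).
  by rewrite /x' eq_sym (negPf (neq_lift _ _)); apply: rP.
have x'E : ideal_gen (range x') = ideal_gen (range x).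
  apply/seteqP; split; apply: ideal_gen_min; try exact: is_ideal_gen.
    move=> _ [i _ <-]; have hx := is_ideal_gen (range x).
    have xgen j : ideal_gen (range x) (x j) by apply: ideal_gen_incl; exists j.
    rewrite /x'; case: ifP => _ //.
    by apply: (ideal_sub hx) => //; apply: (ideal_mull _ hx).
  move=> _ [i _ <-]; have hx := is_ideal_gen (range x').
  have xgen j : ideal_gen (range x') (x' j) by apply: ideal_gen_incl; exists j.
  have [->|ni0] := eqVneq i i0; first by rewrite -x'max.
  rewrite -[x i](subrK (r i * x i0)); apply: (ideal_add hx); last first.
    by apply: (ideal_mull _ hx); rewrite -x'max.
  have <- : x' (tau i) = x i - r i * x i0; last exact: xgen.
  by rewrite /x' tpermK -(inj_eq (@perm_inj _ tau)) tpermK /tau tpermR (negPf ni0).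
have x'param : regular_system_of_parameters x' by split; rewrite ?x'E.
pose y := x' ord_max; pose P := ideal_gen (range (x' \o lift ord_max)).
have PJ : P `<=` J by apply: (ideal_gen_min hJ) => _ [i _ <-]; apply: x'J.
have mE : ideal_gen (range x) = ideal_adjoin P y by rewrite -x'E ideal_gen_last.
have /cid [N JN] : exists n, J (y ^+ n).
  by apply: Jnil; rewrite mE; apply: ideal_adjoin_mem; apply: is_ideal_gen.
have ex_t : exists n, `[< J (y ^+ n) >] by exists N; apply/asboolP.
case: (ex_minnP ex_t) => t /asboolP Jt tmin.
exists d.+1, x', t; split=> //.
  by rewrite lt0n; apply/eqP => t0; apply: nJ1; rewrite t0 in Jt.
rewrite -/(goto_generator x' t) goto_ideal_last -/P -/y; apply/seteqP; split.
  move=> z Jz.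
  have mPy : ideal_gen (range x) `<=` ideal_adjoin P y by rewrite mE.
  have [//|[k [g [u [kt Pg nmu zE]]]]] := power_expansion z t (is_ideal_gen _) mPy.
  have /asboolP/tmin : J (y ^+ k).
    apply: (local_unit_cancel A_noeth A_local hJ nmu).
    rewrite (_ : u * _ = z - g); last by rewrite zE; ring.
    by apply: ideal_sub => //; apply: PJ.
  by rewrite leqNgt kt.
by move=> _ [g Pg [r' ->]]; apply: ideal_add => //; [apply: PJ|apply: ideal_mull].
Qed.

(** Otherwise the other [d] parameters would generate the maximal ideal up to
    radical, and the dimension would be at most [d]. *)
Lemma last_parameter_not_nilpotent d (x : 'I_d.+1 -> A) n :
  regular_system_of_parameters x ->
  ~ ideal_gen (range (x \o lift ord_max)) (x ord_max ^+ n).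
Proof.
move=> [A_noeth [[c hc] _] A_local] Pyn.
have [M ME] := local_prime A_noeth A_local.
(* The maximal ideal contains all parameters and may serve as the top prime. *)
pose c' i := if i == d.+1 then M else c i.
have hc' : prime_chain d.+1 c'.
  move=> i; rewrite ltnS leq_eqVlt => /orP[/eqP->|i_d]; rewrite /c'.
    rewrite eqxx ltn_eqF //; have [cd ncd] := hc d (leqnn _).
    have cM : [set` c d.+1] `<=` [set` M].
      rewrite ME; apply: (proper_sub_local A_noeth A_local); first exact: is_ideal_prime.
      exact/negP/prime_notin1.
    split; first exact: subset_trans cM.
    by move=> Mc; apply: ncd; apply: subset_trans Mc.
  by rewrite !ltn_eqF ?ltnS ?(ltnW i_d) //; apply: hc; rewrite ltnW.
have c'd : c' d.+1 = M by rewrite /c' eqxx.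
have := @krull_height A A_noeth d.+1 c' (codom (x \o lift ord_max)) hc'.
rewrite size_codom card_ord ltnn c'd => h; apply: (notF (h _ _)).
  move=> _ /codomP[i ->]; have : [set` M] (x (lift ord_max i)); last by [].
  by rewrite ME; apply: ideal_gen_incl; exists (lift ord_max i).
move=> q _ qM qxs; rewrite ME ideal_gen_last.
have Pq : ideal_gen (range (x \o lift ord_max)) `<=` [set` q].
  apply: ideal_gen_min; first exact: is_ideal_prime.
  by move=> _ [i _ <-]; apply: qxs; apply: codom_f.
move=> _ [g /Pq qg [r ->]]; apply: (ideal_add (is_ideal_prime q) qg).
by apply: (ideal_mull _ (is_ideal_prime q)); apply: prime_expP (Pq _ Pyn).
Qed.

Lemma ideal_pow_sub I n : is_ideal I -> (0 < n)%N -> ideal_pow I n `<=` I.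
Proof.
case: n => // n hI _; apply: ideal_mul_min => // x y Ix _; exact: ideal_mulr.
Qed.

Lemma ideal_pow_adjoin P y t i : is_ideal P ->
  ideal_pow (ideal_adjoin P (y ^+ t)) i `<=` ideal_adjoin P (y ^+ (t * i)).
Proof.
move=> hP; elim: i => [|i ih].
  by move=> x _; exists 0; [case: hP|exists x; rewrite muln0 expr0 mulr1 add0r].
apply: ideal_mul_min; first exact: is_ideal_adjoin.
move=> _ b [g Pg [r ->]] /ih[h Ph [s ->]].
exists (g * (h + s * y ^+ (t * i)) + r * y ^+ t * h).
  by apply: ideal_add => //; [apply: ideal_mulr|apply: ideal_mull].
by exists (r * s); rewrite mulnS exprD; ring.
Qed.

(** Let [m = P + (y)]. In the discrete valuation ring [A / P] the ideal becomes
    [(y ^+ t)]; an element [z] of value [k < t] cannot be integral over it, since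
    in the equation of integral dependence [z ^+ n] has value [k * n] and all
    other terms have larger values. *)
Lemma goto_type_integrally_closed J : ci_goto_type J -> integral_closure J `<=` J.
Proof.
move=> [d [x [t [xparam t_gt0 JE]]]] z [n [a [n_gt0 aJ zn0]]].
have [A_noeth _ A_local] := xparam.
have hJ : is_ideal J by rewrite JE; apply: is_ideal_gen.
case: d x xparam JE A_local => [|d] x xparam JE A_local.
  have Jm : J = ideal_gen (range x).
    have x0 : range (goto_generator x t) = range x by apply/seteqP; split=> y [[]].
    by rewrite JE -/(goto_generator x t) x0.
  rewrite Jm; apply: contrapT => /(local_unit_exp A_noeth A_local (n := n)); apply.
  rewrite -Jm -[z ^+ n](addrK (\sum_(1 <= i < n.+1) a i * z ^+ (n - i))) zn0 sub0r.
  apply: ideal_opp => //; rewrite big_nat; apply: ideal_sum => // i /[dup] /andP[i_gt0 _] /aJ.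
  by move=> /(ideal_pow_sub hJ i_gt0); apply: ideal_mulr.
move: JE; rewrite -/(goto_generator x t) goto_ideal_last => JE.
pose P := ideal_gen (range (x \o lift ord_max)); pose y := x ord_max.
have hP : is_ideal P := is_ideal_gen _.
have mE := ideal_gen_last x; rewrite -/P -/y in JE mE.
have mPy : ideal_gen (range x) `<=` ideal_adjoin P y by rewrite mE.
rewrite JE; have [//|[k [g [u [kt Pg nmu zE]]]]] := power_expansion z t hP mPy.
case: (@last_parameter_not_nilpotent d x (k * n)) => //; rewrite -/P -/y.
have hQ j := is_ideal_adjoin (y ^+ j) hP.
have zpow j : ideal_adjoin P (y ^+ (k * j)) (z ^+ j) /\ P (z ^+ j - u ^+ j * y ^+ (k * j)).
  have Pz : P (z ^+ j - u ^+ j * y ^+ (k * j)).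
    rewrite exprM -exprMn subrXX zE addrK; exact: (ideal_mulr _ hP).
  split=> //; exists (z ^+ j - u ^+ j * y ^+ (k * j)) => //.
  by exists (u ^+ j); rewrite subrK.
have [h Ph [r sumE]] : ideal_adjoin P (y ^+ (k * n).+1)
    (\sum_(1 <= i < n.+1) a i * z ^+ (n - i)).
  rewrite big_nat; apply: ideal_sum => // i /[dup] /andP[i_gt0 i_n] /aJ.
  rewrite JE => /(ideal_pow_adjoin hP)[b Pb [s ->]].
  have [[e Pe [w ->]] _] := zpow (n - i)%N.
  exists (b * (e + w * y ^+ (k * (n - i))) + s * y ^+ (t * i) * e).
    by apply: (ideal_add hP); [apply: (ideal_mulr _ hP)|apply: (ideal_mull _ hP)].
  have [l lE] : exists l, (t * i + k * (n - i) = (k * n).+1 + l)%N.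
    exists (t * i + k * (n - i) - (k * n).+1)%N; rewrite subnKC //.
    by rewrite -{1}(subnKC (i_n : i <= n)%N) mulnDr ltn_add2r ltn_mul2r i_gt0.
  exists (s * w * y ^+ l).
  rewrite -[s * w * y ^+ l * _]mulrA -exprD addnC -lE exprD; ring.
apply: (local_unit_cancel A_noeth A_local hP (u := u ^+ n + r * y)).
  have my : ideal_gen (range x) (r * y).
    by rewrite mE; apply: (ideal_mull _ (is_ideal_adjoin y hP)); apply: ideal_adjoin_mem.
  move=> h'; apply: (local_unit_exp A_noeth A_local nmu (n := n)).
  by rewrite -[u ^+ n](addrK (r * y)); apply: ideal_sub my => //; apply: is_ideal_gen.
rewrite (_ : _ * _ = - (z ^+ n - u ^+ n * y ^+ (k * n)) - h).
  by apply: (ideal_sub hP) => //; apply: (ideal_opp hP); case: (zpow n).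
move: zn0; rewrite sumE exprS => /eqP; rewrite addr_eq0 => /eqP->; ring.
Qed.

End GotoType.

(** * Integral dependence *)

Section IntegralDependence.
Variable R : comNzRingType.
Implicit Types (I J K L : set R) (a b x y z : R).

Lemma is_ideal_pow I n : is_ideal (ideal_pow I n).
Proof. by case: n => [|n]; [split|apply: is_ideal_mul]. Qed.

Lemma ideal_powD I m n x y : ideal_pow I m x -> ideal_pow I n y ->
  ideal_pow I (m + n) (x * y).
Proof.
move=> Imx Iny; elim: m x Imx => [|m ih] x.
  by move=> _; apply: ideal_mull => //; apply: is_ideal_pow.
have hI := is_ideal_pow I (m + n).+1.
pose K := [set x | ideal_pow I (m + n).+1 (x * y)].
apply: (@ideal_mul_min _ I (ideal_pow I m) K).
  rewrite /K; split=> [|a u v] /=; first by rewrite mul0r; case: hI.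
  by rewrite mulrDl -mulrA; case: hI => _; apply.
by move=> u v Iu /ih Iv; rewrite /K /= -mulrA; apply: ideal_mul_incl.
Qed.

(** The component of degree [n] of the polynomial ring in [X] over the Rees
    algebra [R[I T]], with [X] and [T] of degree one, dehomogenised by [T = 1]. *)
Definition rees I n : set {poly R} :=
  [set f | forall i, if (i <= n)%N then ideal_pow I (n - i) f`_i else f`_i = 0].

Lemma rees_mul I m n f g : rees I m f -> rees I n g -> rees I (m + n) (f * g).
Proof.
move=> hf hg i; rewrite coefM; case: ifP => i_mn.
  apply: ideal_sum => [|j _]; first exact: is_ideal_pow.
  have h0 := ideal_zero (is_ideal_pow I (m + n - i)).
  move: (hf j) (hg (i - j)%N); case: ifP => [jm|_ -> _]; last by rewrite mul0r.
  case: ifP => [ijn|_ _ ->]; last by rewrite mulr0.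
  move=> hfj hgj; rewrite (_ : (m + n - i = (m - j) + (n - (i - j)))%N).
    exact: ideal_powD.
  by have := ltn_ord j; lia.
apply: big1 => j _; move: (hf j) (hg (i - j)%N).
case: ifP => [jm _|_ -> _]; last by rewrite mul0r.
case: ifP => [ijn _|_ ->]; last by rewrite mulr0.
by have := ltn_ord j; lia.
Qed.

Lemma rees_const I a n : ideal_pow I n a -> rees I n a%:P.
Proof.
move=> Ia i; rewrite coefC; case: eqVneq => [->|_]; first by rewrite subn0.
by case: ifP => // _; apply: (ideal_zero (is_ideal_pow _ _)).
Qed.

Lemma rees_add I n f g : rees I n f -> rees I n g -> rees I n (f + g).
Proof.
move=> hf hg i; rewrite coefD; move: (hf i) (hg i); case: ifP => _.
  exact: ideal_add (is_ideal_pow _ _).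
by move=> -> ->; rewrite addr0.
Qed.

Lemma rees_X I : rees I 1 'X.
Proof.
move=> i; rewrite coefX; case: i => [|[|i]] //=.
exact: (ideal_zero (is_ideal_mul _ _)).
Qed.

Lemma rees_opp I n f : rees I n f -> rees I n (- f).
Proof.
move=> h i; rewrite coefN; have := h i; case: ifP => _; last by move=> ->; rewrite oppr0.
by apply: ideal_opp; apply: is_ideal_pow.
Qed.

Lemma rees_det I n (M : 'M[{poly R}]_n) :
  (forall i j, rees I 1 (M i j)) -> rees I n (\det M).
Proof.
move=> hM; have h0 k : rees I k 0 by apply: rees_const; apply: (ideal_zero (is_ideal_pow _ _)).
rewrite /determinant; elim/big_ind: _ => // [f g|s _]; first exact: rees_add.
have hprod : rees I n (\prod_i M i (s i)).
  rewrite -[X in rees I X _](card_ord n) -sum1_card.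
  elim/big_rec2: _ => [|i m f _ hf]; first exact: rees_const.
  exact: rees_mul.
by rewrite mulr_sign; case: ifP => // _; apply: rees_opp.
Qed.

Lemma rees_integral I n f z : (0 < n)%N -> rees I n f -> f \is monic ->
  size f = n.+1 -> f.[z] = 0 -> integral_closure I z.
Proof.
move=> n_gt0 hf f_monic f_size fz0; exists n, (fun i => f`_(n - i)); split=> //.
  by move=> i /andP[i_gt0 i_n]; have := hf (n - i)%N; rewrite leq_subr subKn.
have fn : f`_n = 1 by move/eqP: f_monic; rewrite lead_coefE f_size.
rewrite -[RHS]fz0 horner_coef f_size -(big_mkord xpredT (fun i => f`_i * z ^+ i)).
rewrite [RHS]big_nat_recr //= fn mul1r addrC; congr (_ + _).
rewrite big_add1 /= big_nat_rev /=; apply: eq_big_nat => i /andP[_ i_n].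
by have -> : (n - (0 + n - i.+1).+1 = i)%N by lia.
Qed.

Lemma ideal_mul_combination I (s : seq R) x : is_ideal I ->
    ideal_mul I (ideal_gen [set` s]) x ->
  exists a : 'I_(size s) -> R, (forall j, I (a j)) /\ x = \sum_j a j * s`_j.
Proof.
pose comb K := [set x | exists a : 'I_(size s) -> R,
  (forall j, K (a j)) /\ x = \sum_j a j * s`_j].
have hcomb K : is_ideal K -> is_ideal (comb K).
  move=> hK; split.
    exists (fun=> 0); split=> [_|]; first by case: hK.
    by rewrite big1 // => j _; rewrite mul0r.
  move=> c _ _ [a [Ka ->]] [b [Kb ->]]; exists (fun j => c * a j + b j).
  split=> [j|]; first by case: hK => _; apply.
  by rewrite mulr_sumr -big_split; apply: eq_bigr => j _; rewrite mulrDl mulrA.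
move=> hI; apply: (ideal_mul_min (hcomb I hI)) => u v Iu.
move/(@ideal_gen_min _ [set` s] (comb setT)); case.
- exact: hcomb.
- move=> _ /(nthP 0)[i i_s <-]; exists (fun j => (j == Ordinal i_s)%:R); split=> //.
  rewrite (bigD1 (Ordinal i_s)) //= eqxx mul1r big1 ?addr0 // => j /negPf ->.
  by rewrite mul0r.
- move=> a [_ ->]; exists (fun j => u * a j); split=> [j|]; first exact: ideal_mulr.
  by rewrite mulr_sumr; apply: eq_bigr => j _; rewrite mulrA.
Qed.

(** The determinant trick, with the characteristic polynomial of the matrix by
    which [z] acts on generators of [L]. Its value at [z] annihilates [L], and in
    particular [z] itself. *)
Lemma determinant_trick I L z : noetherian R -> is_ideal I -> is_ideal L ->
  L z -> (forall l, L l -> ideal_mul I L (z * l)) -> integral_closure I z.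
Proof.
move=> R_noeth hI hL Lz zL; have [s sL] := R_noeth L hL.
have /choice[M hM] : forall i : 'I_(size s), exists a : 'I_(size s) -> R,
    (forall j, I (a j)) /\ z * s`_i = \sum_j a j * s`_j.
  move=> i; apply: ideal_mul_combination => //; rewrite -sL; apply: zL.
  by rewrite sL; apply: ideal_gen_incl; apply: mem_nth.
pose N : 'M[R]_(size s) := \matrix_(i, j) M i j.
have eval_det : (char_poly N).[z] = \det (z%:M - N).
  rewrite -/(horner_eval z _) -det_map_mx; congr (\det _).
  apply/matrixP => i j; rewrite !mxE /= /horner_eval hornerD hornerN hornerC.
  by rewrite hornerMn hornerX.
have Ns : (z%:M - N) *m (\col_i s`_i) = 0.
  apply/matrixP => i k; rewrite mulmxBl mul_scalar_mx !mxE.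
  have [_ ->] := hM i; apply/eqP; rewrite subr_eq0; apply/eqP.
  by apply: eq_bigr => j _; rewrite !mxE.
have det_s (i : 'I_(size s)) : (char_poly N).[z] * s`_i = 0.
  have /matrixP/(_ i ord0) : \adj (z%:M - N) *m ((z%:M - N) *m (\col_i s`_i)) = 0.
    by rewrite Ns mulmx0.
  by rewrite mulmxA mul_adj_mx mul_scalar_mx !mxE eval_det.
have det_z : (char_poly N).[z] * z = 0.
  suff : L `<=` [set x | (char_poly N).[z] * x = 0] by apply.
  rewrite sL; apply: ideal_gen_min => [|_ /(nthP 0)[i i_s <-]].
    split=> [|a x y /=]; first by rewrite /= mulr0.
    by move=> zx zy; rewrite mulrDr mulrCA zx zy mulr0 addr0.
  exact: (det_s (Ordinal i_s)).
(* The factor ['X] accounts for the last multiplication by [z]. *)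
apply: (@rees_integral I (size s + 1) (char_poly N * 'X)).
- by rewrite addn1.
- apply: rees_mul; last exact: rees_X.
  apply: rees_det => i j; rewrite !mxE -polyCN; apply: rees_add.
    case: (i == j) => /=; first exact: rees_X.
    by apply: rees_const; apply: (ideal_zero (is_ideal_pow _ _)).
  apply: rees_const; apply: (ideal_opp (is_ideal_pow _ _)).
  by rewrite -[M i j]mulr1; apply: ideal_mul_incl => //; case: (hM i).
- by rewrite rpredM ?char_poly_monic ?monicX.
- by rewrite size_mulX ?monic_neq0 ?char_poly_monic // size_char_poly addn1.
- by rewrite hornerM hornerX.
Qed.

End IntegralDependence.

(** * Localization at a prime *)

Section LocalizationTheory.
Local Open Scope quotient_scope.
Variables (R : comNzRingType) (p : prime_idealr R).
Implicit Types (I J K L : set R) (a b r s u v : R) (x y z : localization p).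
Import Localization.

Lemma tolocal_is_zmod_morphism : zmod_morphism (tolocal p).
Proof.
move=> a b; change (tolocal p (a - b) = add (tolocal p a) (opp (tolocal p b))).
by rewrite !piE; apply: frac_eq; rewrite !fracE; ring.
Qed.

Lemma tolocal_is_monoid_morphism : monoid_morphism (tolocal p).
Proof.
split=> // a b; change (tolocal p (a * b) = mul (tolocal p a) (tolocal p b)).
by rewrite !piE; apply: frac_eq; rewrite !fracE; ring.
Qed.

HB.instance Definition _ :=
  GRing.isZmodMorphism.Build R (localization p) (tolocal p) tolocal_is_zmod_morphism.
HB.instance Definition _ :=
  GRing.isMonoidMorphism.Build R (localization p) (tolocal p) tolocal_is_monoid_morphism.

Lemma local_fraction x : exists a s, s \notin p /\ tolocal p s * x = tolocal p a.
Proof.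
elim/quotW: x => x; exists (num x), (den x); split; first exact: denP.
change (mul (tolocal p (den x)) (\pi_(localization p) x) = tolocal p (num x)).
by rewrite !piE; apply: frac_eq; rewrite !fracE; ring.
Qed.

Lemma tolocal_unit s : s \notin p -> exists x, tolocal p s * x = 1.
Proof.
move=> ps; exists (\pi_(localization p) (mkfrac 1 ps)).
change (mul (tolocal p s) (\pi_(localization p) (mkfrac 1 ps)) = tolocal p 1).
by rewrite !piE; apply: frac_eq; rewrite !fracE; ring.
Qed.

Lemma tolocal_eq0 a : tolocal p a = 0 -> exists2 u, u \notin p & u * a = 0.
Proof.
change (tolocal p a = tolocal p 0 -> exists2 u, u \notin p & u * a = 0).
rewrite !piE => /eqmodP/asboolP[u pu]; rewrite !fracE mulr1 mul0r mulr0 => ua0.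
by exists u.
Qed.

End LocalizationTheory.

Section LocalizedIdeals.
Variables (R : comNzRingType) (p : prime_idealr R).
Implicit Types (I J K L : set R) (a b r s u v : R) (x y z : localization p).
Local Notation phi := (tolocal p).
Local Notation loc := (ideal_localization p).

Lemma is_ideal_localization K : is_ideal (loc K).
Proof. exact: is_ideal_gen. Qed.

Lemma localization_incl K a : K a -> loc K (phi a).
Proof. by move=> Ka; apply: ideal_gen_incl; exists a. Qed.

Lemma localization_cancel (J : set (localization p)) s x :
  is_ideal J -> s \notin p -> J (phi s * x) -> J x.
Proof.
move=> hJ /tolocal_unit[y sy] Jsx; rewrite -[x]mul1r -sy mulrAC mulrC.
exact: ideal_mull.
Qed.

Lemma localization_fraction K x : is_ideal K -> loc K x ->
  exists a s, [/\ s \notin p, K a & phi s * x = phi a].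
Proof.
move=> hK; pose T x := exists a s, [/\ s \notin p, K a & phi s * x = phi a].
apply: (@ideal_gen_min _ _ T); last first.
  by move=> _ [a Ka <-]; exists a, 1; rewrite prime_notin1 rmorph1 mul1r.
split.
  by exists 0, 1; rewrite prime_notin1 rmorph0 mulr0; split=> //; case: hK.
move=> c y z [a [s [ps Ka sy]]] [b [t [pt Kb tz]]].
have [d [w [pw wc]]] := local_fraction c.
exists (t * d * a + w * s * b), (w * s * t); split.
- by rewrite !prime_notin_mul.
- by apply: ideal_add => //; apply: ideal_mull.
rewrite !rmorphD !rmorphM /= -sy -tz -wc; ring.
Qed.

Lemma localizationP K a : is_ideal K -> loc K (phi a) <-> saturation p K a.
Proof.
move=> hK; split=> [/(localization_fraction hK)[b [s [ps Kb e]]]|[u pu Kua]].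
  have [|u pu e0] := @tolocal_eq0 R p (s * a - b).
    by rewrite rmorphB rmorphM /= e subrr.
  exists (u * s); first exact: prime_notin_mul.
  rewrite (_ : _ * a = u * b); first exact: ideal_mull.
  by apply/eqP; rewrite -subr_eq0 -mulrA -mulrBr e0.
apply: (localization_cancel (is_ideal_localization K) pu).
by rewrite -rmorphM; apply: localization_incl.
Qed.

Lemma localized_prime (q : prime_idealr R) : [set` q] `<=` [set` p] ->
  exists Q : prime_idealr (localization p), [set` Q] = loc [set` q].
Proof.
move=> qp; have hq := is_ideal_prime q; have hL := is_ideal_localization [set` q].
have locq a : loc [set` q] (phi a) -> a \in q.
  by move/(localizationP _ hq)/(saturation_prime qp).
apply: prime_of_set => // [|x y].
  by rewrite -(rmorph1 phi) => /locq; apply/negP/prime_notin1.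
have [a [s [ps sx]]] := local_fraction x; have [b [t [pt ty]]] := local_fraction y.
move=> Lxy; have /locq/prime_mulP[qa|qb] : loc [set` q] (phi (a * b)).
- by rewrite rmorphM /= -sx -ty mulrACA; apply: (ideal_mull _ hL).
- by left; apply: (localization_cancel hL ps); rewrite sx; apply: localization_incl.
- by right; apply: (localization_cancel hL pt); rewrite ty; apply: localization_incl.
Qed.

Lemma localized_prime_chain n (c : nat -> prime_idealr R) :
  prime_chain n c -> [set` c n] `<=` [set` p] -> krull_dim_ge (localization p) n.
Proof.
move=> hc cp; have cip i : (i <= n)%N -> [set` c i] `<=` [set` p].
  by move=> i_n; apply: subset_trans cp; apply: (prime_chain_sub hc); rewrite i_n leqnn.
have /choice[Q QE] : forall i, exists Q : prime_idealr (localization p),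
    (i <= n)%N -> [set` Q] = loc [set` c i].
  move=> i; have [/cip/localized_prime[Q QE]|_] := boolP (i <= n)%N; first by exists Q.
  by have [Q _] := localized_prime (cip 0%N (leq0n n)); exists Q.
exists Q => i i_n; rewrite !QE //; last exact: ltnW.
have [ci nci] := hc i i_n; split.
  apply: ideal_gen_min; first exact: is_ideal_localization.
  by move=> _ [a ca <-]; apply: localization_incl; apply: ci.
move=> h; apply: nci => a ca.
have /h/(localizationP _ (is_ideal_prime _)) : loc [set` c i.+1] (phi a).
  exact: localization_incl.
by move/saturation_prime; apply; apply: cip; apply: ltnW.
Qed.

Lemma local_ring_maximal m a : noetherian (localization p) -> local_ring_with m ->
  m (phi a) <-> a \in p.
Proof.
move=> A_noeth A_local; split=> [ma|pa].
  by apply: contrapT => /negP/tolocal_unit[x ax]; apply: (unit_notin_local A_local ax).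
have hp := is_ideal_prime p.
apply: (proper_sub_local A_noeth A_local (is_ideal_localization [set` p])).
  rewrite -(rmorph1 phi) => /(localizationP _ hp)[u pu].
  by rewrite mulr1; apply/negP.
exact: localization_incl.
Qed.

Lemma localization_mul K L x y : is_ideal K -> is_ideal L ->
  loc K x -> loc L y -> loc (ideal_mul K L) (x * y).
Proof.
move=> hK hL /(localization_fraction hK)[a [s [ps Ka sx]]].
move=> /(localization_fraction hL)[b [t [pt Lb ty]]].
apply: (localization_cancel (is_ideal_localization _) (prime_notin_mul ps pt)).
rewrite rmorphM /= mulrACA sx ty -rmorphM.
by apply: localization_incl; apply: ideal_mul_incl.
Qed.

Lemma localization_pow I n a : ideal_pow I n a -> ideal_pow (loc I) n (phi a).
Proof.
elim: n a => // n ih a; pose K := [set a | ideal_pow (loc I) n.+1 (phi a)].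
have hn := is_ideal_pow (loc I) n.+1.
apply: (@ideal_mul_min _ I (ideal_pow I n) K) => [|b c Ib Ic].
  rewrite /K; split=> [|r b c] /=; first by rewrite rmorph0; apply: ideal_zero hn.
  by move=> hb hc; rewrite rmorphD rmorphM; apply: (ideal_add hn) => //; apply: (ideal_mull _ hn).
by rewrite /K /= rmorphM; apply: ideal_mul_incl; [apply: localization_incl|apply: ih].
Qed.

Lemma localization_integral I (z : R) :
  integral_closure I z -> integral_closure (loc I) (phi z).
Proof.
move=> [n [a [n_gt0 aI zn0]]]; exists n, (phi \o a); split=> //.
  by move=> i /aI; apply: localization_pow.
rewrite -[RHS](rmorph0 phi) -zn0 rmorphD rmorphXn rmorph_sum /=; congr (_ + _).
by apply: eq_bigr => i _; rewrite rmorphM rmorphXn.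
Qed.

End LocalizedIdeals.

(** * Passage between R and its localizations at the minimal primes *)

Section MinimalPrimes.
Variables (R : comNzRingType) (I : set R).
Hypothesis R_noeth : noetherian R.
Hypothesis I_ideal : is_ideal I.
Implicit Types (p q : prime_idealr R).

(** The radical is the intersection of the primes that contain [I]. *)
Lemma is_ideal_radical : is_ideal (radical I).
Proof.
have radP x : (forall q, I `<=` [set` q] -> x \in q) -> radical I x.
  move=> hx; apply: contrapT => /(radical_prime R_noeth I_ideal)[q [Iq /negP]].
  by apply; apply: hx.
have prime_rad x q : radical I x -> I `<=` [set` q] -> x \in q.
  by move=> [n Ixn] Iq; apply: prime_expP (Iq _ Ixn).
split; first by apply: radP => q _; apply: idealr0.
move=> a x y Ix Iy; apply: radP => q Iq.
by rewrite rpredD // ?idealMr //; apply: prime_rad.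
Qed.

Lemma radical_sub_prime p : I `<=` [set` p] -> radical I `<=` [set` p].
Proof. by move=> Ip x [n Ixn]; apply: prime_expP (Ip _ Ixn). Qed.

Let L := ideal_colon I (radical I).

(** [sqrt I * L^2] is [(sqrt I * L) L], and [sqrt I * L] lies in [I]. *)
Lemma radical_sub_colon : radical I `<=` ideal_colon (ideal_mul I L) (ideal_pow L 2).
Proof.
move=> r rI b; rewrite mulrC; have hIL := @is_ideal_mul _ I L.
pose K := [set b | ideal_mul I L (b * r)].
apply: (@ideal_mul_min _ L (ideal_pow L 1) K) => [|l l' Ll].
  rewrite /K; split=> [|a x y] /=; first by rewrite mul0r; apply: ideal_zero hIL.
  by rewrite mulrDl -mulrA => hx hy; apply: (ideal_add hIL) => //; apply: (ideal_mull _ hIL).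
have hL : is_ideal L by apply: is_ideal_colon.
move/(ideal_pow_sub (n := 1) hL isT) => Ll'; rewrite /K /= mulrAC.
by apply: ideal_mul_incl => //; apply: Ll.
Qed.

(** Minimal primes of [I] are associated to [I], so [L = I : sqrt I] is strictly
    larger than [I] at each of them. *)
Lemma colon_radical_notin_saturation p : minimal_prime I p ->
  exists2 y, L y & ~ saturation p I y.
Proof.
move=> [Ip pmin]; have hS := is_ideal_saturation p I_ideal.
have nS1 : ~ saturation p I 1.
  by move=> [u pu]; rewrite mulr1 => /Ip /= up; rewrite up in pu.
have [y [q [nSy qE]]] := exists_prime_colon R_noeth hS nS1.
rewrite mulr1 in nSy qE.
have qp : [set` q] `<=` [set` p].
  move=> s; rewrite qE /= => Ssy; apply: contrapT => /negP ps.
  exact/nSy/(saturation_cancel ps).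
have pq : [set` p] `<=` [set` q].
  apply: contrapT => npq; apply: (pmin q); last by split.
  by move=> x Ix; rewrite qE /=; apply: ideal_mulr => //; apply: saturation_sub.
have hIy : is_ideal [set r | I (r * y)].
  split=> [|a x z] /=; first by rewrite mul0r; case: I_ideal.
  by rewrite mulrDl -mulrA; case: I_ideal => _; apply.
have [|u pu uy] := common_denominator R_noeth (p := p) hIy is_ideal_radical.
  move=> b /(radical_sub_prime Ip)/pq; rewrite qE => -[u pu Iuby].
  by exists u => //=; rewrite -mulrA.
exists (u * y) => [b /uy /=|/(saturation_cancel pu)//].
by rewrite mulrAC.
Qed.

(** An element of [IL : L^2] outside [p] would carry an element of [L] outside
    [I_p] into the integral closure of [I], by the determinant trick. *)
Lemma colon_sub_radical : integrally_closed I ->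
  ideal_colon (ideal_mul I L) (ideal_pow L 2) `<=` radical I.
Proof.
move=> I_closed r rL; apply: contrapT => /(radical_prime R_noeth I_ideal)[q [Iq qr]].
have [p pmin pq] := exists_minimal_prime R_noeth I_ideal Iq.
have [y Ly nSy] := colon_radical_notin_saturation pmin.
have hL : is_ideal L by apply: is_ideal_colon.
apply: nSy; exists r; first by apply: contra qr => /pq.
have : integral_closure I (r * y); last by rewrite I_closed.
apply: (@determinant_trick _ I L) => //; first exact: (ideal_mull _ hL).
move=> l Ll; rewrite -mulrA; apply: rL; rewrite -[y * l]mulr1 -mulrA.
by apply: ideal_mul_incl => //; apply: ideal_mul_incl.
Qed.

(** Together with the converse below: [L] localizes to [I_p : m], because
    [sqrt I] is finitely generated and localizes to [m]. *)
Lemma colon_maximal_localization p m x : minimal_prime I p ->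
    noetherian (localization p) -> local_ring_with m ->
  ideal_colon (ideal_localization p I) m x -> ideal_localization p L x.
Proof.
move=> [Ip pmin] A_noeth A_local Jx.
have [a [s [ps sx]]] := local_fraction x.
have hL : is_ideal L by apply: is_ideal_colon.
apply: (localization_cancel (is_ideal_localization _ L) ps); rewrite sx.
apply/(localizationP _ _ hL).
have hIa : is_ideal [set r | I (r * a)].
  split=> [|b y z] /=; first by rewrite mul0r; case: I_ideal.
  by rewrite mulrDl -mulrA; case: I_ideal => _; apply.
have [|u pu ua] := common_denominator R_noeth (p := p) hIa is_ideal_radical.
  move=> b /(radical_sub_prime Ip)/(local_ring_maximal _ A_noeth A_local)/Jx Jxb.
  have /(localizationP _ _ I_ideal)[u pu Iu] : ideal_localization p I (tolocal p (b * a)).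
    rewrite rmorphM /= -sx mulrCA [_ * x]mulrC.
    exact: (ideal_mull _ (is_ideal_localization _ I)).
  by exists u => //=; rewrite -mulrA.
by exists u => // b /ua /=; rewrite mulrAC.
Qed.

Lemma localization_colon_maximal p m l : minimal_prime I p ->
    noetherian (localization p) -> local_ring_with m ->
  L l -> ideal_colon (ideal_localization p I) m (tolocal p l).
Proof.
move=> pmin A_noeth A_local Ll x mx.
have hm : is_ideal m by exact: local_ideal A_local.
have [a [s [ps sx]]] := local_fraction x.
have /(local_ring_maximal _ A_noeth A_local) pa : m (tolocal p a).
  by rewrite -sx; apply: (ideal_mull _ hm).
have [u pu Iua] := minimal_prime_nilpotent R_noeth I_ideal pmin pa.
apply: (localization_cancel (is_ideal_localization _ I) (prime_notin_mul pu ps)).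
rewrite rmorphM /= mulrCA -mulrA sx -!rmorphM.
by apply: localization_incl; apply: Ll.
Qed.

Lemma localization_primary p m x : minimal_prime I p ->
    noetherian (localization p) -> local_ring_with m -> m x ->
  exists n, ideal_localization p I (x ^+ n).
Proof.
move=> pmin A_noeth A_local mx; have [a [s [ps sx]]] := local_fraction x.
have hm : is_ideal m by exact: local_ideal A_local.
have /(local_ring_maximal _ A_noeth A_local) pa : m (tolocal p a).
  by rewrite -sx; apply: (ideal_mull _ hm).
have [u pu [n Iuan]] := minimal_prime_nilpotent R_noeth I_ideal pmin pa.
have pus : (u * s) ^+ n \notin p.
  by apply: contra (prime_notin_mul pu ps); apply: prime_expP.
exists n; apply: (localization_cancel (is_ideal_localization _ I) pus).
by rewrite rmorphXn rmorphM /= -exprMn -mulrA sx -rmorphM -rmorphXn; apply: localization_incl.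
Qed.

End MinimalPrimes.

(** [A / J] is zero-dimensional, so the double annihilator condition there pulls
    back to [A]. *)
Lemma gorenstein_double_annihilator (A : comNzRingType) (m J : set A) :
    noetherian A -> local_ring_with m -> (forall x, m x -> exists n, J (x ^+ n)) ->
    gorenstein_ideal J ->
  forall b c, (forall r, J (r * b) -> J (r * c)) -> exists a, J (c - a * b).
Proof.
move=> A_noeth A_local Jm [K KE [B_noeth _ B_fid]] b c Jbc.
have piP x y : (\pi_{ideal_quot K} x = \pi_{ideal_quot K} y)%qT <-> J (x - y).
  rewrite -KE; split=> [/eqP|Kxy]; first by rewrite -Quotient.idealrBE.
  by apply/eqP; rewrite -Quotient.idealrBE.
pose pi := (\pi_{ideal_quot K})%qT.
have B_zerodim (x : {ideal_quot K}) : (exists y, x * y = 1) \/ exists n, x ^+ n = 0.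
  elim/quotW: x => x; have [/Jm[n Jxn]|/(local_unit A_noeth A_local)[v xv]] := pselect (m x).
    right; exists n; rewrite -rmorphXn -[RHS](rmorph0 pi); apply/piP.
    by rewrite subr0.
  by left; exists (pi v); rewrite -rmorphM /= xv rmorph1.
have [|a] := double_annihilator B_noeth B_zerodim B_fid (b := pi b) (c := pi c).
  elim/quotW=> r; rewrite -!rmorphM -(rmorph0 pi) => /piP.
  by rewrite subr0 => /Jbc h; apply/piP; rewrite subr0.
elim/quotW: a => a; rewrite -rmorphM => /piP h; by exists a.
Qed.

Section GenericGotoType.
Variables (R : comNzRingType) (I : set R).
Hypothesis R_noeth : noetherian R.
Hypothesis I_ideal : is_ideal I.
Let L := ideal_colon I (radical I).

(** At a minimal prime [p], incomparable elements modulo [I_p] would put [L^2]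
    inside [IL] at [p], so that [IL : L^2] would leave [p]. *)
Lemma generically_goto_type :
    generically gorenstein_ideal I ->
    (forall p, minimal_prime I p -> regular_local_ring (localization p)) ->
    radical I = ideal_colon (ideal_mul I L) (ideal_pow L 2) ->
  generically ci_goto_type I.
Proof.
move=> I_gor R_reg radE p pmin; have [Ip _] := pmin.
have [d [x x_param]] := R_reg p pmin; have [A_noeth _ A_local] := x_param.
have hJ := is_ideal_localization p I; have hL := is_ideal_colon (radical I) I_ideal.
have Jm y := localization_primary R_noeth I_ideal (x := y) pmin A_noeth A_local.
have Jgor := gorenstein_double_annihilator A_noeth A_local Jm (I_gor p pmin).
apply: (goto_type_of_chain_ring x_param hJ _ Jm).
  rewrite -(rmorph1 (tolocal p)) => /(localizationP _ _ I_ideal)[u pu].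
  by rewrite mulr1 => /Ip; apply/negP.
move=> x1 x2; apply: contrapT => /not_orP[/forallNP n12 /forallNP n21].
have LL_IL l1 l2 : L l1 -> L l2 -> saturation p (ideal_mul I L) (l1 * l2).
  move=> Ll1 Ll2; apply/localizationP; first exact: is_ideal_mul.
  have := socle_product A_noeth A_local hJ Jm Jgor n12 n21
    (localization_colon_maximal R_noeth I_ideal pmin A_noeth A_local Ll1)
    (localization_colon_maximal R_noeth I_ideal pmin A_noeth A_local Ll2).
  rewrite -rmorphM; apply: ideal_mul_min; first exact: is_ideal_localization.
  move=> y z Jy /(colon_maximal_localization R_noeth I_ideal pmin A_noeth A_local).
  exact: localization_mul.
have [|||u pu uIL] := common_denominator R_noeth (p := p) (J := ideal_mul I L) (K := ideal_pow L 2).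
- exact: is_ideal_mul.
- exact: is_ideal_mul.
- apply: ideal_mul_min; first exact/is_ideal_saturation/is_ideal_mul.
  by move=> l1 l2 Ll1 /(ideal_pow_sub (n := 1) hL isT); apply: LL_IL.
move/negP: pu; apply; apply: (radical_sub_prime Ip); rewrite radE.
exact: uIL.
Qed.

(** The height of a minimal prime of [I] is finite, so unmixedness makes every
    associated prime of [I] minimal. *)
Lemma height_unmixed_associated_minimal (q : prime_idealr R) : height_unmixed I ->
    (forall p, minimal_prime I p -> regular_local_ring (localization p)) ->
    associated_prime I q -> minimal_prime I q.
Proof.
move=> [_ _ unmixed] R_reg q_ass.
have Iq : I `<=` [set` q].
  by have [x ->] := q_ass => a Ia /=; apply: ideal_mulr.
have [p pmin pq] := exists_minimal_prime R_noeth I_ideal Iq; have [Ip pP] := pmin.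
have [qp|nqp] := pselect ([set` q] `<=` [set` p]).
  split=> // q' Iq' [q'q nqq']; apply: (pP q' Iq').
  by split=> [x /q'q/qp//|pq']; apply: nqq' => x /qp/pq'.
have [d [_ [_ [_ dim_d] _]]] := R_reg p pmin.
have nht : ~ prime_height_ge p d.+1.
  move=> [c hc cE]; apply: dim_d; apply: localized_prime_chain hc _.
  by rewrite cE.
(* [n] is the height of [p]; the larger prime [q] would have height [n.+1]. *)
have [n [pn npn]] : exists n, prime_height_ge p n /\ ~ prime_height_ge p n.+1.
  apply: contrapT => /forallNP h; apply: nht; elim: d.+1 => [|k ih].
    by exists (fun=> p).
  by apply: contrapT => npk; apply: (h k).
case: npn; apply: ((unmixed q q_ass _).1 _ p Ip).
have [c hc cE] := pn.
exists (fun i => if i == n.+1 then q else c i); last by rewrite eqxx.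
move=> i; rewrite ltnS => i_n; rewrite ltn_eqF ?ltnS //.
have [->|ni] := eqVneq i n; first by rewrite eqxx cE; split.
by rewrite eqSS (negPf ni); apply: hc; rewrite ltn_neqAle ni.
Qed.

(** If [z] is not in [I], some associated prime of [I] is the annihilator modulo
    [I] of a multiple of [z], and there [z] stays outside the extension of [I]. *)
Lemma generically_mem z : height_unmixed I ->
    (forall p, minimal_prime I p -> regular_local_ring (localization p)) ->
    (forall p, minimal_prime I p -> saturation p I z) -> I z.
Proof.
move=> unmixed R_reg Iz; apply: contrapT => nIz.
have [r [q [nIrz qE]]] := exists_prime_colon R_noeth I_ideal nIz.
have qmin : minimal_prime I q.
  by apply: height_unmixed_associated_minimal => //; exists (r * z).
have [u qu Iuz] := Iz q qmin.
move/negP: qu; apply; have : [set` q] u; last by [].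
by rewrite qE /= mulrCA; apply: ideal_mull.
Qed.

Lemma goto_type_generically_closed : height_unmixed I ->
    (forall p, minimal_prime I p -> regular_local_ring (localization p)) ->
    generically ci_goto_type I -> integrally_closed I.
Proof.
move=> unmixed R_reg I_goto; apply/seteqP; split=> z Iz; last first.
  exists 1%N, (fun=> - z); split=> //; last first.
    by rewrite big_nat1 subnn expr0 mulr1 expr1 subrr.
  case=> [|[|i]] // _; rewrite -[- z]mulr1; apply: ideal_mul_incl => //.
  exact: ideal_opp.
apply: generically_mem => // p pmin; apply/(localizationP _ _ I_ideal).
apply: (goto_type_integrally_closed (I_goto p pmin)).
exact: localization_integral.
Qed.

End GenericGotoType.

Theorem theorem3p9 (R : comNzRingType) (I : set R)
    (R_noetherian : noetherian R)
    (I_unmixed : height_unmixed I)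
    (I_gorenstein : generically gorenstein_ideal I)
    (R_regular : forall p : prime_idealr R,
       minimal_prime I p -> regular_local_ring (localization p)) :
  let L := ideal_colon I (radical I) in
  (integrally_closed I <->
     radical I = ideal_colon (ideal_mul I L) (ideal_pow L 2)) /\
  (integrally_closed I \/
     radical I = ideal_colon (ideal_mul I L) (ideal_pow L 2) ->
   generically ci_goto_type I).
Proof.
move=> L; have [I_ideal _ _] := I_unmixed.
have closed_rad : integrally_closed I ->
    radical I = ideal_colon (ideal_mul I L) (ideal_pow L 2).
  move=> I_closed; apply/seteqP; split; first exact: radical_sub_colon.
  exact: colon_sub_radical.
have goto := generically_goto_type R_noetherian I_ideal I_gorenstein R_regular.
split; last by case=> [/closed_rad|]; apply: goto.
by split=> // /goto; apply: goto_type_generically_closed.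
Qed.
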